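(* Let $n\ge 2$ and let $X$ be a finite set of distinct points in $\mathbb{P}^n$ over an algebraically closed field, spanning $\mathbb{P}^n$. Then $a_{n-1}(X)\neq 0$ if and only if either the points of $X$ lie on a rational normal curve of $\mathbb{P}^n$, or there are positive integers $k$ and $r$ with $k+r=n$ such that $X$ is contained in the union $\mathbb{P}^k\cup\mathbb{P}^r$ of a $k$-dimensional and an $r$-dimensional linear subspace of $\mathbb{P}^n$.
   Context: Let $k$ be an algebraically closed field (the ground field; the letter $k$ is also used for a dimension), $\mathbb{P}^n=\mathbb{P}^n_k$, $R=k[x_0,\dots,x_n]$. $X=\{P_1,\dots,P_s\}$ is a set of $s\ge n+1$ distinct points of $\mathbb{P}^n$ not contained in any hyperplane (''spanning $\mathbb{P}^n$''), $I=I(X)\subset R$ is its defining homogeneous ideal, and $A=R/I$. For $i=1,\dots,n$, $a_i(X)=\dim_k[\mathrm{Tor}_i^R(A,k)]_{i+1}$, i.e. the multiplicity of the shift $i+1$ in the $i$-th module of the minimal graded free resolution of $A$ over $R$. The ''either ... or'' is not exclusive. *)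

(* Defs.v *)
From mathcomp Require Import all_boot all_order all_algebra.
From mathcomp Require Import finmap mpoly.

Set Implicit Arguments.
Unset Strict Implicit.
Unset Printing Implicit Defensive.

Import GRing.Theory.
Local Open Scope ring_scope.

Section ProjectiveSpace.
Variables (K : fieldType) (n : nat).

(* P^n as the set of lines through the origin of K^(n+1).  Accordingly a
   k-dimensional linear subspace of P^n is an L : {vspace 'rV[K]_n.+1} with
   \dim L = k.+1, and the point P lies on it iff (val P <= L)%VS. *)
Definition pspace := {P : {vspace 'rV[K]_n.+1} | \dim P == 1%N}.

Definition spanning (X : {fset pspace}) : Prop :=
  (\sum_(P <- X) val P)%VS = fullv.

Definition vanishes_at (f : {mpoly K[n.+1]}) (P : pspace) : Prop :=
  forall v : 'rV[K]_n.+1, v \in val P -> f.@[v 0] = 0.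

(* I(X): the ideal generated by the forms vanishing at all points of X. *)
Definition point_ideal (X : {fset pspace}) (f : {mpoly K[n.+1]}) : Prop :=
  exists gs : seq ({mpoly K[n.+1]} * {mpoly K[n.+1]}),
    (forall g, g \in gs ->
       (exists d : nat, g.2 \is d.-homog) /\
       (forall P, P \in X -> vanishes_at g.2 P))
    /\ f = \sum_(g <- gs) g.1 * g.2.

Definition veronese (s t : K) : 'rV[K]_n.+1 :=
  \row_(i < n.+1) (s ^+ (n - i) * t ^+ i).

(* A rational normal curve is the image of the standard one, the image of
   [s : t] |-> [s^n : s^(n-1) t : ... : t^n], under a projectivity g of P^n. *)
Definition on_rational_normal_curve (X : {fset pspace}) : Prop :=
  exists2 g : 'M[K]_n.+1, g \in unitmx &
    forall P, P \in X -> exists s t : K,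
      (s, t) != (0, 0) /\ val P = <[veronese s t *m g]>%VS.

Definition on_linear_union (X : {fset pspace}) (k r : nat) : Prop :=
  exists L M : {vspace 'rV[K]_n.+1},
    [/\ \dim L = k.+1, \dim M = r.+1
      & forall P, P \in X -> (val P <= L)%VS \/ (val P <= M)%VS].

End ProjectiveSpace.

Section Tor.
Variables (K : fieldType) (m : nat).
Local Notation R := {mpoly K[m]}.

(* The zero polynomial is homogeneous of every degree, and is the only one
   homogeneous of a negative degree. *)
Definition homog_deg (d : int) (f : R) : Prop :=
  forall u, u \in msupp f -> (mdeg u)%:Z = d.

(* A graded free resolution ... -> F_2 -> F_1 -> F_0 -> R/I -> 0 by finitely
   generated modules F_i = \bigoplus_a R(- gr_shift i a).  Elements of F_i are
   row vectors and maps act by right multiplication.  The augmentation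
   F_0 -> R/I is given by a homogeneous lift gr_aug : F_0 -> R. *)
Record graded_free_resolution (I : R -> Prop) := GradedFreeResolution {
  gr_rank : nat -> nat;
  gr_shift : forall i, 'I_(gr_rank i) -> int;
  gr_diff : forall i, 'M[R]_(gr_rank i.+1, gr_rank i);
  gr_aug : 'cV[R]_(gr_rank 0);
  gr_diff_homog : forall i a b,
    homog_deg (gr_shift a - gr_shift b) (gr_diff i a b);
  gr_aug_homog : forall a, homog_deg (gr_shift a) (gr_aug a 0);
  gr_aug_surj : forall f : R,
    exists v : 'rV[R]_(gr_rank 0), I (f - (v *m gr_aug) 0 0);
  gr_exact0 : forall v : 'rV[R]_(gr_rank 0),
    I ((v *m gr_aug) 0 0) <-> exists w, v = w *m gr_diff 0;
  gr_exact : forall i (v : 'rV[R]_(gr_rank i.+1)),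
    v *m gr_diff i = 0 <-> exists w, v = w *m gr_diff i.+1
}.

Variables (I : R -> Prop) (F : graded_free_resolution I).

(* The differential of F \otimes_R K, where K = R/(x_0, ..., x_(m-1)): reduction
   modulo the variables takes constant coefficients. *)
Definition tor_diff i : 'M[K]_(gr_rank F i.+1, gr_rank F i) :=
  map_mx (mcoeff 0%MM) (gr_diff F i).

Definition tor_cycles i : 'M[K]_(gr_rank F i) :=
  match i with
  | 0 => 1%:M
  | i'.+1 => kermx (tor_diff i')
  end.

(* The row space of this matrix is the degree j part of F_i \otimes_R K. *)
Definition deg_part i (j : int) : 'M[K]_(gr_rank F i) :=
  diag_mx (\row_a (gr_shift a == j)%:R).

(* dim_K [Tor_i^R(R/I, K)]_j, as the dimension of the degree j cycles minus
   that of the degree j boundaries. *)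
Definition tor_dim i (j : int) : nat :=
  (\rank (deg_part i j :&: tor_cycles i)%MS
   - \rank (deg_part i.+1 j *m tor_diff i))%N.

Definition minimal_resolution : Prop :=
  forall i a b, (gr_diff F i a b)@_0%MM = 0.

Lemma tor_dim_minimal i j : minimal_resolution ->
  tor_dim i j = #|[set a : 'I_(gr_rank F i) | gr_shift a == j]|.
Proof.
move=> Fmin.
have d0 k : tor_diff k = 0 by apply/matrixP => a b; rewrite !mxE Fmin.
have cyc1 : (1%:M <= tor_cycles i)%MS.
  by case: i => [|i] /=; [rewrite submx1 | rewrite d0 sub_kermx mulmx0].
rewrite /tor_dim d0 mulmx0 mxrank0 subn0.
have /capmx_idPl -> : (deg_part i j <= tor_cycles i)%MS.
  exact: submx_trans (submx1 _) cyc1.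
set S := [set a | _].
pose B : 'M[K]_(#|S|, gr_rank F i) := rowsub enum_val 1%:M.
have DE : deg_part i j = B^T *m B.
  apply/matrixP => a b; rewrite !mxE.
  under eq_bigr => x _ do rewrite !mxE.
  rewrite -(big_enum_val (fun x => (x == a)%:R * (x == b)%:R)) /=.
  rewrite big_mkcond (bigD1 a) //= big1 => [|x /negbTE xa]; last first.
    by rewrite xa mul0r if_same.
  by rewrite addr0 inE eqxx mul1r; case: (_ == j); case: (a == b).
have BBt : B *m B^T = 1%:M.
  apply/matrixP => a b; rewrite !mxE (bigD1 (enum_val a)) //= big1 => [|x xa].
    by rewrite !mxE eqxx mul1r addr0 (inj_eq enum_val_inj) eq_sym.
  by rewrite !mxE eq_sym (negbTE xa) mul0r.
apply/eqP; rewrite eqn_leq DE (leq_trans (mxrankM_maxr _ _) (rank_leq_row _)) /=.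
rewrite -[X in (X <= _)%N](mxrank1 K) -[1%:M]mulmx1 -BBt.
rewrite mulmxA -(mulmxA B) (leq_trans (mxrankM_maxl _ _)) //.
by rewrite mxrankM_maxr.
Qed.

End Tor.

(* a_i(X) = dim_K [Tor_i^R(R/I(X), K)]_(i+1), computed from an arbitrary graded
   free resolution F of R/I(X). *)
Definition a_ (K : fieldType) (n : nat) (X : {fset pspace K n})
    (F : graded_free_resolution (point_ideal X)) (i : nat) : nat :=
  tor_dim F i i.+1%:Z.

(* Main.v *)
From HB Require Import structures.
Require Import Defs.
From mathcomp Require Import all_boot all_order all_algebra.
From mathcomp Require Import finmap mpoly.
From mathcomp Require Import ring zify.
From Stdlib Require Classical_Prop.

(** Let [W] be the space of row vectors, so that the points of [X] are lines of
    [W].  In wedge form the Koszul complex has as [p]-cochains the families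
    [f(S)], [#|S| = p], with differential [f |-> x /\ f], and the usual zigzag
    through the resolution identifies [Tor_(n-1)(R/I, K)_n] with the second
    cohomology in internal degree 1.  A class is thus a linear map
    [b : W -> /\^2 W] with [x /\ b(x) = 0] for every [x] on a line of [X], and it
    is trivial iff [b(x) = x /\ w] for a fixed [w].  Bivectors are represented by
    alternating matrices.

    If [e_0, ..., e_n] are points of [X] forming a basis, then
    [b(e_i) = e_i /\ a_i], and a vector [c = sum c_i e_i] of [X] satisfies
    [c_p c_q (a_qr - a_pr) + c_q c_r (a_rp - a_qp) + c_r c_p (a_pq - a_rq) = 0]
    for all [p, q, r]; triviality means that each column [a_.r] is constant off
    the diagonal.  If for some proper subset [S] of size at least 2 each column
    [r] outside [S] is constant on [S], then [X] lies on two linear spaces: for a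
    maximal such [S] this is immediate unless [b - (. /\ w)] has a kernel of
    dimension at least 2 for some [w], and that case is settled by a closure
    argument on the directed graph of the nonzero [a_rs].  Otherwise every [c]
    in [X] is one of the [e_i] or has no zero coordinate, and in the inverse
    coordinates [1 / c_i] the relations become linear, with a solution space
    spanned by two vectors: this is the inverse coordinate description of a
    rational normal curve through the [e_i]. *)

Set Implicit Arguments.
Unset Strict Implicit.
Unset Printing Implicit Defensive.

Import GRing.Theory.
Local Open Scope ring_scope.

(** * Relations in a frame *)

Section Coordinates.
Variables (K : fieldType) (N : nat).
Implicit Types (a M : 'M[K]_N) (c v w l : 'rV[K]_N) (X : seq 'rV[K]_N).
Implicit Types (S T : {set 'I_N}).

Definition wedge v w : 'M[K]_N := \matrix_(p, q) (v 0 p * w 0 q - v 0 q * w 0 p).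

(** The coefficient of [v /\ M] at [e_p /\ e_q /\ e_r], for an alternating matrix [M]. *)
Definition wedge3 v M p q r := v 0 p * M q r + v 0 q * M r p + v 0 r * M p q.

(** The bivector [b(c)] for the linear map with [b(e_i) = e_i /\ a_i], where [a_i] is row [i] of
    [a]. The diagonal of [a] cancels, as [e_i /\ e_i = 0]. *)
Definition frame_map a c : 'M[K]_N :=
  \matrix_(p, q) (c 0 p * a p q - c 0 q * a q p).

Definition compatible a c := forall p q r, wedge3 c (frame_map a c) p q r = 0.

Lemma compatibleP a c : compatible a c <-> forall p q r,
  c 0 p * c 0 q * (a q r - a p r) + c 0 q * c 0 r * (a r p - a q p)
  + c 0 r * c 0 p * (a p q - a r q) = 0.
Proof.
have E p q r : wedge3 c (frame_map a c) p q r =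
  c 0 p * c 0 q * (a q r - a p r) + c 0 q * c 0 r * (a r p - a q p)
  + c 0 r * c 0 p * (a p q - a r q).
  by rewrite /wedge3 !mxE; ring.
by split=> H p q r; move: (H p q r); rewrite E.
Qed.

Lemma wedge3_wedge v w p q r : wedge3 v (wedge v w) p q r = 0.
Proof. by rewrite /wedge3 !mxE; ring. Qed.

(** Exactness of multiplication by a nonzero vector. The cofactor is row [p] of [M] divided by a
    nonzero coordinate [v 0 p]. *)
Lemma wedge3_eq0 v M : v != 0 -> M^T = - M ->
  (forall p q r, wedge3 v M p q r = 0) -> exists w, M = wedge v w.
Proof.
move=> v0 MT H.
have [p vp]: exists p, v 0 p != 0.
  apply/existsP; apply: contraNT v0; rewrite negb_exists => /forallP v0.
  by apply/eqP/rowP => i; rewrite mxE; apply/eqP; move: (v0 i); rewrite negbK.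
exists (\row_q (M p q / v 0 p)); apply/matrixP => q r; rewrite !mxE.
have := H p q r; rewrite /wedge3.
have -> : M r p = - M p r by move/matrixP: MT => /(_ p r); rewrite !mxE.
move=> /eqP; rewrite mulrN -addrA addr_eq0 => /eqP E.
by apply: (mulfI vp); rewrite E; field.
Qed.

(** Vector space dimensions exceed projective ones by one: for [N = n.+1] the last bound says that
    the projective dimensions add up to at most [n]. The spaces are enlarged to exact dimensions
    later. *)
Definition in_two_planes X :=
  exists L M : {vspace 'rV[K]_N},
    [/\ (\dim L < N)%N, (\dim M < N)%N, (\dim L + \dim M <= N.+1)%N
      & forall c, c \in X -> c \in L \/ c \in M].

(** One space is spanned by the [e_i] with [i] outside [T], the other by [l] and the [e_i] with [i]
    in [T]. *)
Lemma coord_split_in_two_planes X T l :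
  T != set0 -> (#|T|.+1 < N)%N ->
  (forall c, c \in X -> (forall i, i \in T -> c 0 i = 0)
     \/ exists s, forall i, i \notin T -> c 0 i = s * l 0 i) ->
  in_two_planes X.
Proof.
move=> T0 cardT H.
pose spT (A : {set 'I_N}) : {vspace 'rV[K]_N} :=
  <<[seq (delta_mx 0 i)%R | i <- enum A]>>%VS.
have memT (A : {set _}) (c : 'rV[K]_N) :
      (forall i, i \notin A -> c 0 i = 0) -> c \in spT A.
  move=> cA; rewrite [c]row_sum_delta; apply: rpred_sum => i _.
  have [iA|/cA ->] := boolP (i \in A); last by rewrite scale0r mem0v.
  by apply/rpredZ/memv_span/map_f; rewrite mem_enum.
have dimT (A : {set _}) : (\dim (spT A) <= #|A|)%N.
  by rewrite (leq_trans (dim_span _)) // size_map -cardE.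
have dl : (\dim <[l]> <= 1)%N by rewrite dim_vline; case: (l == 0).
have dL : (\dim (<[l]> + spT T) <= #|T|.+1)%N.
  exact: leq_trans (dimv_add_leqif _ _) (leq_add dl (dimT T)).
have cardC : (#|T| + #|~: T| = N)%N by rewrite cardsC card_ord.
exists (<[l]> + spT T)%VS, (spT (~: T)); split.
- exact: leq_ltn_trans dL _.
- apply: leq_ltn_trans (dimT _) _; rewrite -[X in (_ < X)%N]cardC.
  by rewrite -[X in (X < _)%N]add0n ltn_add2r card_gt0.
- by rewrite (leq_trans (leq_add dL (dimT _))) // addSn cardC.
move=> c /H [cT|[s cT]]; [right|left].
  by apply: memT => i; rewrite inE negbK => /cT.
rewrite -[c](subrK (s *: l)) addrC; apply: memv_add; first exact: rpredZ (memv_line _).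
by apply: memT => i /cT E; rewrite !mxE E subrr.
Qed.


(** * Linear maps to bivectors and change of frame *)

Definition lin_form (B : 'I_N -> 'M[K]_N) c : 'M[K]_N := \sum_i c 0 i *: B i.

Lemma wedgeE v w : wedge v w = v^T *m w - w^T *m v.
Proof. by apply/matrixP=> p q; rewrite !mxE !big_ord1 !mxE [w 0 p * _]mulrC. Qed.

Lemma wedge_mulmx v w (E : 'M[K]_N) :
  wedge (v *m E) (w *m E) = E^T *m wedge v w *m E.
Proof. by rewrite !wedgeE !trmx_mul mulmxBr mulmxBl !mulmxA. Qed.

Lemma frame_mapE a c : frame_map a c = diag_mx c *m a - a^T *m diag_mx c.
Proof.
apply/matrixP=> p q; rewrite mul_diag_mx mul_mx_diag !mxE.
by rewrite [a q p * _]mulrC.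
Qed.

Lemma frame_mapT a c : (frame_map a c)^T = - frame_map a c.
Proof. by apply/matrixP=> p q; rewrite !mxE opprB. Qed.

Lemma frame_map_lin_form a c :
  frame_map a c = lin_form (fun i => wedge (delta_mx 0 i) (row i a)) c.
Proof.
apply/matrixP=> p q; rewrite !mxE summxE.
under eq_bigr do rewrite !mxE mulrBr !mulrA.
rewrite sumrB (bigD1 p) //= big1 ?addr0; last first.
  by move=> i /negbTE ip; rewrite eq_sym ip mulr0 mul0r.
rewrite (bigD1 q) //= big1 ?addr0; last first.
  by move=> i /negbTE ip; rewrite eq_sym ip mulr0 mul0r.
by rewrite !eqxx !mulr1.
Qed.

Lemma lin_form_mulmx B c (E : 'M[K]_N) :
  lin_form B (c *m E) = \sum_i c 0 i *: lin_form B (row i E).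
Proof.
rewrite /lin_form; under [RHS]eq_bigr do rewrite scaler_sumr.
rewrite exchange_big; apply: eq_bigr => j _ /=.
rewrite mxE scaler_suml; apply: eq_bigr => i _.
by rewrite scalerA mxE.
Qed.

(** Expressing the cofactors (rows of [V]) in the frame (rows of [E]) gives the matrix
    [V *m invmx E]; a bivector changes coordinates by congruence with [E]. *)
Lemma lin_form_frame B (E V : 'M[K]_N) c : E \in unitmx ->
  (forall i, lin_form B (row i E) = wedge (row i E) (row i V)) ->
  lin_form B (c *m E) = E^T *m frame_map (V *m invmx E) c *m E.
Proof.
move=> uE BE; set a := V *m invmx E.
have VE : V = a *m E by rewrite mulmxKV.
move: a VE => a VE.
rewrite lin_form_mulmx frame_mapE mulmxBr mulmxBl.
have -> : E^T *m (diag_mx c *m a) *m E = E^T *m diag_mx c *m V.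
  by rewrite VE !mulmxA.
have -> : E^T *m (a^T *m diag_mx c) *m E = V^T *m diag_mx c *m E.
  by rewrite VE trmx_mul !mulmxA.
apply/matrixP=> p q; rewrite summxE !mxE -sumrB; apply: eq_bigr => i _.
by rewrite BE !mul_mx_diag !mxE; ring.
Qed.

(** * Closed index sets, and the case where the kernel is spanned by frame vectors *)

Section LargestClosed.
Variables (a : 'M[K]_N) (S : {set 'I_N}) (l : 'rV[K]_N).

(** Closure in the directed graph on the indices outside [S] with an edge [r -> r'] when [a r r'] is
    nonzero, together with proportionality to [l] on [S] of the rows in [Q]. Both conditions pass to
    unions, so there is a largest such set. *)
Definition row_closed (Q : {set 'I_N}) : bool :=
  (Q \subset ~: S) &&
  [forall r in Q, [forall r' in ~: (S :|: Q), a r r' == 0]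
    && [forall p in S, [forall q in S, a r p * l 0 q == a r q * l 0 p]]].

Lemma row_closedP (Q : {set 'I_N}) : reflect
  [/\ forall r, r \in Q -> r \notin S,
      forall r r', r \in Q -> r' \notin S -> r' \notin Q -> a r r' = 0
    & forall r p q, r \in Q -> p \in S -> q \in S ->
        a r p * l 0 q = a r q * l 0 p]
  (row_closed Q).
Proof.
apply: (iffP andP) => [[sQ cQ]|[sQ aQ lQ]].
  split=> [r rQ|r r' rQ r'S r'Q|r p q rQ pS qS].
  - by have := subsetP sQ _ rQ; rewrite inE.
  - have /andP[/forall_inP H _] := forall_inP cQ _ rQ.
    by apply/eqP/H; rewrite !inE negb_or r'S.
  - have /andP[_ /forall_inP H] := forall_inP cQ _ rQ.
    by have /forall_inP/(_ _ qS)/eqP := H _ pS.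
split; first by apply/subsetP => r /sQ; rewrite inE.
apply/forall_inP => r rQ; apply/andP; split.
  by apply/forall_inP => r'; rewrite !inE negb_or => /andP[? ?]; rewrite aQ.
by apply/forall_inP => p pS; apply/forall_inP => q qS; rewrite (lQ r p q).
Qed.

Definition largest_closed := \bigcup_(Q | row_closed Q) Q.

Lemma largest_closedP : row_closed largest_closed.
Proof.
apply/row_closedP; split.
- by move=> r /bigcupP[Q /row_closedP[H _ _] /H].
- move=> r r' /bigcupP[Q cQ rQ] r'S r'T; have /row_closedP[_ H _] := cQ.
  by apply: H => //; apply: contra r'T => r'Q; apply/bigcupP; exists Q.
- by move=> r p q /bigcupP[Q /row_closedP[_ _ H] rQ] pS qS; apply: H.
Qed.

Lemma sub_largest_closed (Q : {set 'I_N}) : row_closed Q -> Q \subset largest_closed.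
Proof. by move=> cQ; apply: bigcup_sup. Qed.

End LargestClosed.

Lemma frame_map_eq0 a c :
  (forall p q, p != q -> c 0 p * a p q = c 0 q * a q p) -> frame_map a c = 0.
Proof.
move=> H; apply/matrixP => p q; rewrite !mxE.
by have [->|/H ->] := eqVneq p q; rewrite subrr.
Qed.

(* [K^N = <e_p, p \in S> + <e_r, r \notin S>], the first summand being the kernel
   of [frame_map a]; a vector [c] is split accordingly into [f + g].  One of the
   two planes is spanned by the [f]-part [l] of a vector with [f, g <> 0] together
   with the largest closed set of [e_r]'s. *)
Lemma coord_kernel_in_two_planes a X S :
  (forall p q, p \in S -> a p q = 0) -> (1 < #|S|)%N -> S != setT ->
  (forall c, frame_map a c = 0 -> forall r, r \notin S -> c 0 r = 0) ->
  (forall c, c \in X -> compatible a c) -> in_two_planes X.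
Proof.
move=> aS cardS SnT kerS Xa.
have cardC (T : {set 'I_N}) : T \subset ~: S -> (#|T|.+1 < N)%N.
  move=> sT; suff: (#|T|.+1 < #|S| + #|~: S|)%N by rewrite cardsC card_ord.
  exact: leq_add cardS (subset_leq_card sT).
have [/hasP[c1 c1X /andP[/exists_inP[p1 p1S c1p1] /exists_inP[r1 r1S c1r1]]]|noX]
  := boolP (has (fun c : 'rV_N => [exists p in S, c 0 p != 0] &&
            [exists r in ~: S, c 0 r != 0]) X); last first.
  apply: (@coord_split_in_two_planes _ (~: S) 0).
  - by rewrite -setCT (inj_eq (@setC_inj _)).
  - exact: cardC.
  move=> c cX; have := hasPn noX _ cX; rewrite negb_and => /orP[] H.
    right; exists 0 => i; rewrite mul0r inE negbK => iS; apply/eqP.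
    by move: H; rewrite negb_exists_in => /forall_inP/(_ _ iS); rewrite negbK.
  left=> i iS; apply/eqP.
  by move: H; rewrite negb_exists_in => /forall_inP/(_ _ iS); rewrite negbK.
(* The relation at [p, r, r'] with [c 0 r' = 0] reduces to [a r r' = 0]; the relation at two indices
   of [S] and one index [r] outside makes row [r] proportional to [c] on [S]. *)
have supp_closed (c l : 'rV_N) p : c \in X -> p \in S -> c 0 p != 0 ->
    (exists2 s, s != 0 & forall q, q \in S -> l 0 q = s * c 0 q) ->
    row_closed a S l [set r | (r \notin S) && (c 0 r != 0)].
  move=> cX pS cp [s s0 lE]; have /compatibleP rel := Xa _ cX.
  apply/row_closedP; split=> [r|r r'|r q q'].
  - by rewrite inE => /andP[].
  - rewrite !inE => /andP[rS cr] r'S; rewrite r'S negbK => /eqP cr'.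
    have := rel p r r'; rewrite cr' (aS p) // subr0 !(mulr0, mul0r) !addr0.
    by move/eqP; rewrite !mulf_eq0 (negbTE cp) (negbTE cr) => /eqP.
  - rewrite inE => /andP[rS cr] qS q'S; have := rel q q' r.
    rewrite !lE // !(aS q) ?(aS q') // subrr mulr0 add0r subr0 sub0r => H.
    apply: (mulfI cr); apply/eqP; rewrite -subr_eq0 -(mulr0 s) -H; apply/eqP.
    by ring.
pose l : 'rV[K]_N := c1; set T := largest_closed a S l.
have cT : row_closed a S l T := largest_closedP _ _ _.
have /row_closedP[TS aT lT] := cT.
have l1 : l 0 p1 != 0 by [].
apply: (@coord_split_in_two_planes _ T (\row_i (if i \in S then l 0 i else 0))).
- apply/set0Pn; exists r1; apply/(subsetP (sub_largest_closed _)).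
    apply: (supp_closed _ _ _ c1X p1S c1p1); exists 1; rewrite ?oner_eq0 // => q _.
    by rewrite mul1r.
  by rewrite inE c1r1 andbT; rewrite inE in r1S.
- by apply: cardC; apply/subsetP => r /TS; rewrite inE.
move=> c cX; have /compatibleP rel := Xa _ cX.
set Q := [set r | (r \notin S) && (c 0 r != 0)].
have [/existsP[p /andP[pS cp]]|f0] := boolP [exists p, (p \in S) && (c 0 p != 0)];
  last first.
  have {}f0 p : p \in S -> c 0 p = 0.
    move=> pS; apply/eqP; move: f0; rewrite negb_exists => /forallP/(_ p).
    by rewrite pS negbK.
  have [/existsP[r /andP[rT cr]]|c0] := boolP [exists r, (r \in T) && (c 0 r != 0)];
    last first.
    left=> r rT; apply/eqP; move: c0; rewrite negb_exists => /forallP/(_ r).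
    by rewrite rT negbK.
  right; exists 0 => i iT; rewrite mul0r.
  have rS := TS _ rT.
  (* The rows in the support of [c] all agree at the zeros of [c], hence with row [r], and [r] lies
     in [T]. So [T :|: Q] is again closed, and maximality of [T] contains the support of [c]. *)
  have aQ s x : s \in Q -> c 0 x = 0 -> a s x = a r x.
    rewrite inE => /andP[_ cs] cx; have := rel r s x; rewrite cx.
    rewrite !(mulr0, mul0r) !addr0 => /eqP.
    by rewrite !mulf_eq0 (negbTE cr) (negbTE cs) subr_eq0 => /eqP.
  suff cTQ : row_closed a S l (T :|: Q).
    have [/f0 //|iS] := boolP (i \in S); apply/eqP; apply: contraNT iT => ci.
    by apply: (subsetP (sub_largest_closed cTQ)); rewrite !inE iS ci orbT.
  apply/row_closedP; split=> [s|s r'|s q q'].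
  - by rewrite inE => /orP[/TS|]; rewrite // inE => /andP[].
  - rewrite !(in_setU s, in_setU r') negb_or => sTQ r'S /andP[r'T r'Q].
    case/orP: sTQ => [sT|sQ]; first exact: aT.
    rewrite (aQ s) //; first exact: aT.
    by apply/eqP; move: r'Q; rewrite inE r'S negbK.
  - rewrite in_setU => /orP[sT|sQ] qS q'S; first exact: lT.
    by rewrite !(aQ s) ?f0 // (lT r).
have [/forall_inP fl|] := boolP [forall q in S, c 0 q * l 0 p == c 0 p * l 0 q].
  right; have lp : l 0 p != 0.
    have := fl _ p1S; apply: contraTneq => ->.
    by rewrite mulr0 eq_sym mulf_neq0.
  have lE q : q \in S -> l 0 q = l 0 p / c 0 p * c 0 q.
    by move=> /fl /eqP; rewrite mulrAC -mulrA => E; apply: (mulfI cp); rewrite -E; field.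
  have /sub_largest_closed/subsetP QT : row_closed a S l Q.
    apply: (supp_closed c l p) => //; exists (l 0 p / c 0 p) => //.
    by rewrite mulf_neq0 ?invr_eq0.
  exists (c 0 p / l 0 p) => i iT; rewrite mxE.
  have [iS|iS] := ifPn; first by rewrite (lE i) //; field; rewrite cp lp.
  by rewrite mulr0; apply/eqP; apply: contraNT iT => ci; apply: QT; rewrite inE iS.
rewrite negb_forall_in => /exists_inP[q qS fl]; left=> r rT.
have /row_closedP[QS aQ cQ] : row_closed a S c Q.
  apply: (supp_closed c c p) => //; exists 1; rewrite ?oner_eq0 // => ? _.
  by rewrite mul1r.
(* On [S] such a row is proportional both to [l] and to [c], which are independent there. *)
have u0 s x : s \in Q :&: T -> x \in S -> a s x = 0.
  rewrite inE => /andP[sQ sT] xS; have ap : a s p = 0.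
    apply/eqP; apply: contraNT fl => ap; apply/eqP/(mulfI ap).
    by rewrite mulrA cQ // [RHS]mulrCA lT //; ring.
  by apply: (mulIf cp); rewrite mul0r (cQ s x p) // ap mul0r.
have D0 x y : x \in Q :&: T -> y \notin Q :&: T -> a x y = 0.
  move=> xD; have [/(u0 x y xD)//|yS] := boolP (y \in S).
  move: xD; rewrite !in_setI => /andP[xQ xT]; rewrite negb_and => /orP[yQ|yT].
    exact: aQ.
  exact: aT.
(* The part of [c] on [Q :&: T] lies in the kernel, which is supported on [S]; hence it is zero and
   [c] vanishes on [T]. *)
pose d : 'rV[K]_N := \row_i (if i \in Q :&: T then c 0 i else 0).
have d0 : frame_map a d = 0.
  apply: frame_map_eq0 => x y _; rewrite !mxE.
  have [xD|xD] := ifPn; have [yD|yD] := ifPn; rewrite ?mul0r //.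
  - have := rel p x y; rewrite (aS p y) // (aS p x) // (u0 x p) // (u0 y p) //.
    move=> H; apply: (mulfI cp); apply/eqP; rewrite -subr_eq0 -H; apply/eqP.
    by ring.
  - by rewrite D0 ?mulr0.
  - by rewrite D0 ?mulr0.
have := kerS _ d0 r (TS _ rT); rewrite mxE.
have [//|rD _] := ifPn; apply/eqP; apply: contraNT rD => cr.
by rewrite in_setI rT andbT in_set cr TS.
Qed.

(** * Kernels of dimension at least two *)

Lemma frame_map_conj_eq0 (E : 'M[K]_N) M :
  E \in unitmx -> E^T *m M *m E = 0 -> M = 0.
Proof.
move=> uE H; have uET : E^T \in unitmx by rewrite unitmx_tr.
by rewrite -[M](mulKmx uET) -[E^T *m M](mulmxK uE) H !(mul0mx, mulmx0).
Qed.

Lemma compatible_frame B (E V : 'M[K]_N) c : E \in unitmx ->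
  (forall i, lin_form B (row i E) = wedge (row i E) (row i V)) ->
  (forall p q r, wedge3 (c *m E) (lin_form B (c *m E)) p q r = 0) ->
  compatible (V *m invmx E) c.
Proof.
move=> uE BE; rewrite (lin_form_frame _ uE BE); set F := frame_map _ _ => H.
have [->|c0] := eqVneq c 0; first by move=> p q r; rewrite /wedge3 !mxE !mul0r !addr0.
have [||w] := wedge3_eq0 _ _ H.
- by apply: contraNneq c0 => cE; rewrite -[c](mulmxK uE) cE mul0mx.
- by rewrite !trmx_mul trmxK frame_mapT mulNmx mulmxN mulmxA.
rewrite -[w](mulmxKV uE) wedge_mulmx => /eqP.
rewrite -subr_eq0 -mulmxBl -mulmxBr => /eqP /(frame_map_conj_eq0 uE) /eqP.
by rewrite subr_eq0 => /eqP FE p q r; rewrite -/F FE wedge3_wedge.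
Qed.

Lemma in_two_planes_mulmx X (E : 'M[K]_N) :
  E \in unitmx -> in_two_planes [seq c *m E | c <- X] -> in_two_planes X.
Proof.
move=> uE [L [M [dL dM dLM HX]]].
pose h : 'End('rV[K]_N) := linfun (mulmxr (invmx E)).
have dh (U : {vspace 'rV[K]_N}) : (\dim (h @: U) <= \dim U)%N.
  by rewrite -[X in (_ <= X)%N](limg_ker_dim h U) leq_addl.
exists (h @: L)%VS, (h @: M)%VS; split.
- exact: leq_ltn_trans (dh _) dL.
- exact: leq_ltn_trans (dh _) dM.
- exact: leq_trans (leq_add (dh _) (dh _)) dLM.
move=> c cX; have -> : c = h (c *m E) by rewrite lfunE /= mulmxK.
by case: (HX _ (map_f _ cX)) => H; [left|right]; apply: memv_img.
Qed.

Lemma frame_map_delta a i :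
  frame_map a (delta_mx 0 i) = wedge (delta_mx 0 i) (row i a).
Proof.
apply/matrixP => p q; rewrite !mxE /=.
by case: eqP => [->|_]; case: eqP => [->|_]; rewrite ?mul0r.
Qed.

(** The frame vector [e_r] is exchanged for the kernel vector [n], whose cofactor is zero; the other
    frame vectors keep their cofactors. *)
Lemma swap_frame a (n : 'rV[K]_N) r : n 0 r != 0 -> frame_map a n = 0 ->
  exists E V : 'M[K]_N, [/\ E \in unitmx,
    forall i, frame_map a (row i E) = wedge (row i E) (row i V),
    row r V = 0 & forall i, i != r -> row i V = row i a].
Proof.
move=> nr an.
exists (\matrix_(i, j) if i == r then n 0 j else (i == j)%:R).
exists (\matrix_(i, j) if i == r then 0 else a i j); split.
- rewrite -row_free_unit; apply: inj_row_free => c cE.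
  have E j : c 0 r * n 0 j + (if j == r then 0 else c 0 j) = 0.
    move/rowP: cE => /(_ j); rewrite !mxE (bigD1 r) //= !mxE eqxx => cE; apply: etrans cE.
    congr (_ + _); case: eqVneq => [->|jr].
      by rewrite big1 // => i /negbTE ir; rewrite mxE ir mulr0.
    rewrite (bigD1 j) //= big1 ?addr0 ?mxE ?(negbTE jr) ?eqxx ?mulr1 //.
    by move=> i /andP[/negbTE ir /negbTE ij]; rewrite mxE ir ij mulr0.
  have cr : c 0 r = 0.
    by apply: (mulIf nr); have := E r; rewrite eqxx /= addr0 mul0r.
  apply/rowP => j; rewrite mxE; have := E j; rewrite cr mul0r add0r.
  by case: eqP => [->|].
- move=> i; have [->|ir] := eqVneq i r.
    have -> : row r (\matrix_(i, j) (if i == r then n 0 j else (i == j)%:R)) = n.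
      by apply/rowP => j; rewrite !mxE eqxx.
    by rewrite an; apply/matrixP => p q; rewrite !mxE eqxx !mulr0 subrr.
  have -> : row i (\matrix_(i, j) (if i == r then n 0 j else (i == j)%:R))
          = delta_mx 0 i :> 'rV[K]_N.
    by apply/rowP => j; rewrite !mxE (negbTE ir) eq_sym.
  rewrite frame_map_delta; congr wedge.
  by apply/rowP => j; rewrite !mxE (negbTE ir).
- by apply/rowP => j; rewrite !mxE eqxx.
- by move=> i /negbTE ir; apply/rowP => j; rewrite !mxE ir.
Qed.

(** Frame vectors are exchanged for kernel vectors until the frame vectors indexed by [S] span the
    kernel. Each exchange enlarges [S], so the induction is on the size of its complement; at the
    end the independent [f] and [f'] force [S] to have two elements. *)
Lemma kernel_in_two_planes a X f f' :
  (forall c, c \in X -> compatible a c) -> (exists c, frame_map a c != 0) ->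
  frame_map a f = 0 -> frame_map a f' = 0 ->
  (forall s s', s *: f + s' *: f' = 0 -> s = 0 /\ s' = 0) ->
  in_two_planes X.
Proof.
suff main m : forall a X f f' S, (#|~: S| <= m)%N ->
    (forall p q, p \in S -> a p q = 0) ->
    (forall c, c \in X -> compatible a c) -> (exists c, frame_map a c != 0) ->
    frame_map a f = 0 -> frame_map a f' = 0 ->
    (forall s s', s *: f + s' *: f' = 0 -> s = 0 /\ s' = 0) -> in_two_planes X.
  by apply: (main #|~: (set0 : {set 'I_N})| _ _ _ _ set0) => // p q; rewrite inE.
elim: m => [|m IH] {}a {}X {}f {}f' S cardS aS Xa [c0 ac0] af af' free.
  case/eqP: ac0; apply/matrixP => p q.
  have ST i : i \in S.
    move: cardS; rewrite leqn0 cards_eq0 => /eqP/setP/(_ i).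
    by rewrite !inE => /negbFE.
  by rewrite !mxE !aS // !mulr0 subrr.
have [[n [an [r rS nr]]]|max] := Classical_Prop.classic
    (exists n, frame_map a n = 0 /\ exists2 r, r \notin S & n 0 r != 0).
  have [E [V [uE aE Vr Vi]]] := swap_frame nr an.
  have := @lin_form_frame (fun i => wedge (delta_mx 0 i) (row i a)) E V _ uE.
  have BE i : lin_form (fun i => wedge (delta_mx 0 i) (row i a)) (row i E)
     = wedge (row i E) (row i V) by rewrite -frame_map_lin_form.
  move=> /(_ _ BE); set a' := V *m invmx E => conj.
  have a'0 g : frame_map a g = 0 -> frame_map a' (g *m invmx E) = 0.
    move=> ag; apply: (frame_map_conj_eq0 uE); rewrite -conj mulmxKV //.
    by rewrite -frame_map_lin_form.
  apply: (in_two_planes_mulmx (E := invmx E)); first by rewrite unitmx_inv.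
  apply: (IH a' _ (f *m invmx E) (f' *m invmx E) (r |: S)).
  - rewrite -ltnS; apply: leq_trans cardS; apply: proper_card.
    rewrite properEneq setCS subsetUr andbT; apply: contra rS => /eqP.
    by move/setC_inj => <-; rewrite setU11.
  - move=> p q; rewrite in_setU1 => pS.
    suff Vp : row p V = 0.
      by have := row_mul p V (invmx E); rewrite Vp mul0mx => /rowP/(_ q); rewrite !mxE.
    move: pS; have [->//|pr /= pS] := eqVneq p r; rewrite Vi //.
    by apply/rowP => j; rewrite !mxE aS.
  - move=> _ /mapP[c cX ->]; apply: (compatible_frame uE BE).
    rewrite mulmxKV // -frame_map_lin_form; exact: Xa.
  - exists (c0 *m invmx E); apply: contraNneq ac0 => H.
    by rewrite frame_map_lin_form -[c0](mulmxKV uE) conj H mulmx0 mul0mx.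
  - exact: a'0.
  - exact: a'0.
  - move=> s s' H; apply: free; rewrite -[LHS](mulmxKV uE) mulmxDl -!scalemxAl H.
    exact: mul0mx.
have {}max c : frame_map a c = 0 -> forall r, r \notin S -> c 0 r = 0.
  move=> ac r rS; apply/eqP; apply: contra_notT max => cr.
  by exists c; split=> //; exists r.
apply: (coord_kernel_in_two_planes aS _ _ max Xa); last first.
  apply: contraNneq ac0 => ST; apply/eqP/matrixP => p q.
  by rewrite !mxE !aS ?ST ?inE // !mulr0 subrr.
rewrite ltnNge; apply/negP => S1.
have f_neq0 : f != 0.
  apply/eqP => f0; have [|/eqP] := free 1 0; last by rewrite oner_eq0.
  by rewrite f0 scaler0 scale0r addr0.
have [S0|[p0 p0S]] := set_0Vmem S.
  case/eqP: f_neq0; apply/rowP => i; rewrite mxE; apply: (max _ af).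
  by rewrite S0 inE.
have Sp0 i : i != p0 -> i \notin S.
  apply: contra => iS; apply/eqP.
  by have /card_le1_eqP/(_ _ _ iS p0S) : (#|S| <= 1)%N by [].
have fE (g : 'rV[K]_N) : frame_map a g = 0 -> g = g 0 p0 *: delta_mx 0 p0.
  move=> ag; apply/rowP => i; rewrite !mxE /=.
  by have [->|ip] := eqVneq i p0; rewrite ?mulr1 // mulr0 (max _ ag) ?Sp0.
have [|f0 /eqP] := free (f' 0 p0) (- f 0 p0).
  by rewrite (fE f) // (fE f') // !scalerA !mxE !eqxx !mulr1 mulNr mulrC scaleNr subrr.
rewrite oppr_eq0 => /eqP f00.
by case/eqP: f_neq0; rewrite (fE f) // f00 scale0r.
Qed.

(** * Subtraction of trivial classes, and columns constant on a set *)

Definition col_shift a w : 'M[K]_N := \matrix_(i, j) (a i j - w 0 j).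

(** The subtracted trivial class contributes [c /\ c /\ w = 0]. *)
Lemma compatible_col_shift a w c : compatible a c -> compatible (col_shift a w) c.
Proof.
move=> /compatibleP H; apply/compatibleP => p q r; rewrite -[RHS](H p q r) !mxE.
by ring.
Qed.

(** Triviality means that every [a_i] equals one [w] modulo [e_i], so that each column is constant
    off the diagonal; this is its failure. *)
Definition nontrivial_frame a :=
  exists p q r, [/\ p != r, q != r & a p r != a q r].

Lemma nontrivial_col_shift a w :
  nontrivial_frame a -> nontrivial_frame (col_shift a w).
Proof.
move=> [p [q [r [pr qr a_]]]]; exists p, q, r; split=> //; rewrite !mxE.
by rewrite (inj_eq (addIr _)).
Qed.

Lemma nontrivial_frame_map a : nontrivial_frame a -> exists c, frame_map a c != 0.
Proof.
move=> [p [q [r [pr qr a_]]]].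
have [ap|ap] := eqVneq (a p r) 0.
  exists (delta_mx 0 q); apply: contraNneq a_ => /matrixP/(_ q r).
  by rewrite !mxE !eqxx mul1r eq_sym (negbTE qr) mul0r subr0 ap => ->.
exists (delta_mx 0 p); apply: contraNneq ap => /matrixP/(_ p r).
by rewrite !mxE !eqxx mul1r eq_sym (negbTE pr) mul0r subr0 => ->.
Qed.

Definition col_constant a S :=
  [forall r in ~: S, forall p in S, forall q in S, a p r == a q r].

Lemma col_constantP a S : reflect
  (forall r p q, r \notin S -> p \in S -> q \in S -> a p r = a q r)
  (col_constant a S).
Proof.
apply: (iffP forall_inP) => [H r p q rS pS qS|H r].
  have /forall_inP/(_ _ pS) /forall_inP/(_ _ qS) /eqP // : [forall p in S,
    forall q in S, a p r == a q r] by apply: H; rewrite inE.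
rewrite inE => rS; apply/forall_inP => p pS; apply/forall_inP => q qS.
by rewrite (H r p q).
Qed.

Lemma col_constant_shift a w S : col_constant (col_shift a w) S = col_constant a S.
Proof.
apply/col_constantP/col_constantP => H r p q rS pS qS.
  by have /eqP := H r p q rS pS qS; rewrite !mxE (inj_eq (addIr _)) => /eqP.
by rewrite !mxE (H r p q).
Qed.

(** Only vectors with nonzero coordinates both in and outside [S] cause trouble. If their [S]-parts
    are proportional, the two spaces are visible. If two are independent, a shift makes the class
    block diagonal and puts both [S]-parts into its kernel. *)
Lemma block_in_two_planes a X S :
  (forall c, c \in X -> compatible a c) -> nontrivial_frame a ->
  (1 < #|S|)%N -> S != setT ->
  (forall T, col_constant a T && (T != setT) -> S \subset T -> T = S) ->
  (forall p r, p \in S -> r \notin S -> a p r = 0) -> in_two_planes X.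
Proof.
move=> Xa nta cardS SnT maxS a0.
have RnZ : ~: S != set0 by rewrite -setCT (inj_eq (@setC_inj _)).
have cardC : (#|~: S|.+1 < N)%N.
  suff: (#|~: S|.+1 < #|S| + #|~: S|)%N by rewrite cardsC card_ord.
  exact: leq_add cardS (leqnn _).
have full c p r r' : c \in X -> p \in S -> c 0 p != 0 -> r \notin S -> c 0 r != 0 ->
    r' \notin S -> c 0 r' != 0.
  move=> cX pS cp rS cr r'S; apply/eqP => cr'.
  have /compatibleP rel := Xa _ cX.
  (* Columns outside [Q] are constant on [Q], and [Q] omits [r'], so maximality gives [Q = S]; but
     [r] lies in [Q] and not in [S]. *)
  pose Q := S :|: [set s | c 0 s != 0].
  have PQ : col_constant a Q && (Q != setT).
    apply/andP; split; last first.
      by apply/eqP => /setP/(_ r'); rewrite !inE (negbTE r'S) cr' eqxx.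
    apply/col_constantP => x y z; rewrite !inE negb_or negbK => /andP[xS /eqP cx].
    have E s : (s \in S) || (c 0 s != 0) -> a s x = 0.
      case/orP=> [sS|cs]; first exact: a0.
      have [sS|sS] := boolP (s \in S); first exact: a0.
      have := rel p s x; rewrite cx (a0 p) // subr0 !(mulr0, mul0r) !addr0.
      by move/eqP; rewrite !mulf_eq0 (negbTE cp) (negbTE cs) => /eqP.
    by move=> /E -> /E ->.
  have := maxS _ PQ (subsetUl _ _) => /setP/(_ r).
  by rewrite !inE (negbTE rS) cr.
pose mixed (c : 'rV[K]_N) :=
  [exists p in S, c 0 p != 0] && [exists r in ~: S, c 0 r != 0].
have mixedN (c : 'rV[K]_N) : ~~ mixed c ->
    (forall i, i \in ~: S -> c 0 i = 0) \/ (forall i, i \in S -> c 0 i = 0).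
  rewrite negb_and => /orP[] H; [right|left] => i iS; apply/eqP.
    by move: H; rewrite negb_exists_in => /forall_inP/(_ _ iS); rewrite negbK.
  by move: H; rewrite negb_exists_in => /forall_inP/(_ _ iS); rewrite negbK.
have [/hasP[c1 c1X mc1]|noX] := boolP (has mixed X); last first.
  apply: (@coord_split_in_two_planes _ (~: S) 0) => // c cX.
  have [|H] := mixedN _ (hasPn noX _ cX); [by left|right].
  by exists 0 => i; rewrite mul0r inE negbK; apply: H.
pose prop (c c' : 'rV[K]_N) :=
  [forall p in S, forall q in S, c 0 p * c' 0 q == c 0 q * c' 0 p].
have /andP[/exists_inP[p1 p1S c1p1] /exists_inP[r1 r1S c1r1]] := mc1.
have {}r1S : r1 \notin S by rewrite inE in r1S.
have [/hasP[c2 c2X /andP[mc2 pr]]|noX] :=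
  boolP (has (fun c => mixed c && ~~ prop c1 c) X); last first.
  apply: (@coord_split_in_two_planes _ (~: S) c1) => // c cX.
  have [mc|/mixedN] := boolP (mixed c); last first.
    case=> H; [by left|right].
    by exists 0 => i; rewrite mul0r inE negbK; apply: H.
  right; exists (c 0 p1 / c1 0 p1) => i; rewrite inE negbK => iS.
  have := hasPn noX _ cX; rewrite mc negbK => /forall_inP/(_ _ p1S).
  move=> /forall_inP/(_ _ iS) /eqP E.
  by apply: (mulfI c1p1); rewrite E; field.
have /andP[/exists_inP[p2 p2S c2p2] /exists_inP[r2 r2S c2r2]] := mc2.
have {}r2S : r2 \notin S by rewrite inE in r2S.
have [x xS [y yS xy]] : exists2 x, x \in S &
    exists2 y, y \in S & c1 0 x * c2 0 y != c1 0 y * c2 0 x.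
  move: pr; rewrite negb_forall_in => /exists_inP[x xS].
  by rewrite negb_forall_in => /exists_inP[y yS xy]; exists x => //; exists y.
have mixrel c p p' r0 r r' : c \in X -> p' \in S -> c 0 p' != 0 -> r0 \notin S ->
    c 0 r0 != 0 -> p \in S -> r \notin S -> r' \notin S ->
    c 0 p * (c 0 r * a r r' - c 0 r' * a r' r)
      = c 0 r * c 0 r' * (a r p - a r' p).
  move=> cX p'S cp' r0S cr0 pS rS r'S; have /compatibleP/(_ p r r') := Xa _ cX.
  rewrite !(a0 p) // => H; apply/eqP; rewrite -subr_eq0 -H; apply/eqP.
  by ring.
have row_eq r r' p : r \notin S -> r' \notin S -> p \in S -> a r p = a r' p.
  move=> rS r'S pS.
  have nz1 := full _ _ _ _ c1X p1S c1p1 r1S c1r1.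
  have nz2 := full _ _ _ _ c2X p2S c2p2 r2S c2r2.
  have E1 z := mixrel c1 z _ _ r r' c1X p1S c1p1 r1S c1r1.
  have E2 z := mixrel c2 z _ _ r r' c2X p2S c2p2 r2S c2r2.
  (* On [S] the difference of rows [r] and [r'] is both [k1 c1] and [k2 c2]; independence of [c1]
     and [c2] there makes it zero. *)
  pose k1 := (c1 0 r * a r r' - c1 0 r' * a r' r) / (c1 0 r * c1 0 r').
  pose k2 := (c2 0 r * a r r' - c2 0 r' * a r' r) / (c2 0 r * c2 0 r').
  have F1 z : z \in S -> a r z - a r' z = c1 0 z * k1.
    by move=> zS; rewrite /k1 mulrA E1 //; field; rewrite !nz1.
  have F2 z : z \in S -> a r z - a r' z = c2 0 z * k2.
    by move=> zS; rewrite /k2 mulrA E2 //; field; rewrite !nz2.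
  suff k0 : k1 = 0 by apply/eqP; rewrite -subr_eq0 F1 // k0 mulr0.
  apply/eqP; apply: contraNT xy => k0; apply/eqP; apply: (mulfI k0).
  have := F1 x xS; rewrite F2 // => Ex; have := F1 y yS; rewrite F2 // => Ey.
  rewrite mulrA [k1 * _]mulrC -Ex [RHS]mulrA [k1 * c1 0 y]mulrC -Ey.
  by ring.
(* The rows outside [S] share their restriction to [S]; subtracting it kills the second off-diagonal
   block and leaves the first one zero. *)
pose u : 'rV[K]_N := \row_j (if j \in S then a r1 j else 0).
pose b := col_shift a u.
have bSR p r : p \in S -> r \notin S -> b p r = 0.
  by move=> pS rS; rewrite !mxE (negbTE rS) subr0 a0.
have bRS p r : p \in S -> r \notin S -> b r p = 0.
  by move=> pS rS; rewrite !mxE pS (row_eq r r1) ?subrr.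
have Xb c : c \in X -> compatible b c by move=> /Xa; apply: compatible_col_shift.
pose S_part (c : 'rV[K]_N) : 'rV[K]_N := \row_j (if j \in S then c 0 j else 0).
have ker c r : c \in X -> r \notin S -> c 0 r != 0 -> frame_map b (S_part c) = 0.
  move=> cX rS cr; apply: frame_map_eq0 => p q _; rewrite ![S_part _ _ _]mxE.
  have [pS|pS] := ifPn; have [qS|qS] := ifPn; rewrite ?mul0r //.
  - have /compatibleP/(_ p q r) := Xb _ cX.
    rewrite !(bSR _ r) // !(bRS _ r) // => H.
    apply: (mulfI cr); apply/eqP; rewrite -subr_eq0 -H; apply/eqP.
    by ring.
  - by rewrite bSR // mulr0.
  - by rewrite bSR // mulr0.
apply: (kernel_in_two_planes Xb (nontrivial_frame_map _)
          (ker _ _ c1X r1S c1r1) (ker _ _ c2X r2S c2r2)).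
  exact: nontrivial_col_shift.
move=> s s' /rowP H; have {}H z : z \in S -> s * c1 0 z + s' * c2 0 z = 0.
  by move=> zS; have := H z; rewrite !mxE zS.
have det0 t : t * (c1 0 x * c2 0 y - c1 0 y * c2 0 x) = 0 -> t = 0.
  by move/eqP; rewrite mulf_eq0 subr_eq0 (negbTE xy) orbF => /eqP.
have Hx := H x xS; have Hy := H y yS.
split; apply: det0.
  transitivity (c2 0 y * (s * c1 0 x + s' * c2 0 x)
                - c2 0 x * (s * c1 0 y + s' * c2 0 y)).
    by ring.
  by rewrite Hx Hy !mulr0 subrr.
transitivity (c1 0 x * (s * c1 0 y + s' * c2 0 y)
              - c1 0 y * (s * c1 0 x + s' * c2 0 x)).
  by ring.
by rewrite Hx Hy !mulr0 subrr.
Qed.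

Lemma col_constant_in_two_planes a X S :
  (forall c, c \in X -> compatible a c) -> nontrivial_frame a ->
  col_constant a S -> (1 < #|S|)%N -> S != setT -> in_two_planes X.
Proof.
move=> Xa nta aS cardS SnT; pose P a S := col_constant a S && (S != setT).
have PS : P a S by rewrite /P aS.
have [S' maxS' SS'] := maxset_exists PS.
have {}cardS : (1 < #|S'|)%N := leq_trans cardS (subset_leq_card SS').
have /andP[{}aS {}SnT] := maxsetp maxS'.
have [p0 p0S] : exists p, p \in S' by apply/set0Pn; rewrite -card_gt0 ltnW.
(* Each column outside [S'] loses its common value on [S']. *)
pose w : 'rV[K]_N := \row_j (if j \in S' then 0 else a p0 j).
have {}maxS' T : P (col_shift a w) T -> S' \subset T -> T = S'.
  by rewrite /P col_constant_shift; apply: maxsetsup maxS'.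
have a0 : forall p r, p \in S' -> r \notin S' -> col_shift a w p r = 0.
  move=> p r pS rS; rewrite !mxE (negbTE rS).
  by have /col_constantP/(_ r p p0) -> := aS; rewrite ?subrr.
apply: (@block_in_two_planes (col_shift a w) X S') => //.
  by move=> c /Xa; apply: compatible_col_shift.
exact: nontrivial_col_shift.
Qed.

End Coordinates.

(** * Rational normal curves in inverse coordinates *)

Section NormalCurve.
Variables (K : fieldType) (n : nat).
Local Notation N := n.+1.
Implicit Types (a : 'M[K]_N) (c d : 'rV[K]_N) (X : seq 'rV[K]_N).

Definition on_normal_curve X :=
  exists2 g : 'M[K]_N, g \in unitmx & forall c, c \in X ->
    exists k s t : K, [/\ k != 0, (s, t) != (0, 0) & c = k *: (veronese n s t *m g)].

Variables (t : 'I_N -> K) (d : 'rV[K]_N).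
Hypotheses (t_inj : injective t) (d_neq0 : forall i, d 0 i != 0).

Definition node_poly (p : 'I_N) : {poly K} := \prod_(j | j != p) ('X - (t j)%:P).

Lemma node_poly_monic p : node_poly p \is monic.
Proof. exact: monic_prod_XsubC. Qed.

Lemma size_node_poly p : size (node_poly p) = N.
Proof.
rewrite /node_poly -big_filter size_prod_XsubC size_filter -sum1_count.
by rewrite sum1_card cardC1 card_ord.
Qed.

Lemma horner_node_poly p x : (node_poly p).[x] = \prod_(j | j != p) (x - t j).
Proof. by rewrite horner_prod; apply: eq_bigr => j _; rewrite !hornerE. Qed.

(** The projectivity taking the standard curve to [x |-> (d_p / (x - t_p))_p], with denominators
    cleared. This curve passes through [e_p] at [x = t_p] and through [d] at infinity. *)
Definition node_curve : 'M[K]_N := \matrix_(i, p) (d 0 p * (node_poly p)`_i).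

Lemma veronese_node_curve x p :
  (veronese n 1 x *m node_curve) 0 p = d 0 p * (node_poly p).[x].
Proof.
rewrite (horner_coef_wide (n := N)) ?size_node_poly // mxE mulr_sumr.
by apply: eq_bigr => i _; rewrite !mxE expr1n; ring.
Qed.

Lemma veronese01_node_curve : veronese n 0 1 *m node_curve = d.
Proof.
apply/rowP => p; rewrite mxE (bigD1 ord_max) //= big1 => [|i im].
  rewrite !mxE subnn expr0 expr1n mulr1 mul1r addr0.
  have /monicP := node_poly_monic p.
  by rewrite lead_coefE size_node_poly /= => ->; rewrite mulr1.
rewrite !mxE expr0n subn_eq0 leqNgt ltn_neqAle -ltnS ltn_ord andbT.
by rewrite (_ : nat_of_ord i != n) // !mul0r.
Qed.

Lemma node_curve_unit : node_curve \in unitmx.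
Proof.
(* Lagrange interpolation: the product with the Vandermonde matrix of the nodes is diagonal with
   nonzero entries. *)
pose V : 'M[K]_N := \matrix_q veronese n 1 (t q).
suff : V *m node_curve \in unitmx by rewrite unitmx_mul => /andP[].
have -> : V *m node_curve = diag_mx (\row_q (d 0 q * (node_poly q).[t q])).
  apply/matrixP => q p; rewrite !mxE.
  transitivity ((veronese n 1 (t q) *m node_curve) 0 p).
    by rewrite mxE; apply: eq_bigr => i _; rewrite !mxE.
  rewrite veronese_node_curve; have [->|qp] := eqVneq q p; first by rewrite mulr1n.
  by rewrite mulr0n horner_node_poly (bigD1 q) //= subrr mul0r mulr0.
rewrite unitmxE det_diag; apply: rpred_prod => q _; rewrite mxE unitfE.
rewrite mulf_neq0 // horner_node_poly; apply/prodf_neq0 => j jq.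
by rewrite subr_eq0 (inj_eq t_inj) eq_sym.
Qed.

(** In inverse coordinates the curve is a line: [d_i / c_i] is affine in [t_i]. Slope zero gives the
    point [d] at infinity, and slope [be] otherwise gives the parameter [- al / be]. *)
Lemma on_node_curve X :
  (forall c, c \in X -> c != 0 ->
     (exists p, forall i, i != p -> c 0 i = 0)
     \/ exists al be, forall i, c 0 i * (al + be * t i) = d 0 i) ->
  (forall c, c \in X -> c != 0) -> on_normal_curve X.
Proof.
move=> H X0; exists node_curve; first exact: node_curve_unit.
move=> c cX; have c0 := X0 _ cX; have [[p cp]|[al [be cE]]] := H _ cX c0.
  have np : (node_poly p).[t p] != 0.
    rewrite horner_node_poly; apply/prodf_neq0 => j jp.
    by rewrite subr_eq0 (inj_eq t_inj) eq_sym.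
  have cp0 : c 0 p != 0.
    apply: contraNneq c0 => cp0; apply/eqP/rowP => i; rewrite mxE.
    by have [->|/cp] := eqVneq i p.
  exists (c 0 p / (d 0 p * (node_poly p).[t p])), 1, (t p); split.
  - by rewrite mulf_neq0 ?invr_eq0 ?mulf_neq0.
  - by rewrite xpair_eqE oner_eq0.
  apply/rowP => i; rewrite mxE veronese_node_curve.
  have [->|ip] := eqVneq i p; first by rewrite divfK ?mulf_neq0.
  rewrite (cp i ip) (horner_node_poly i) (bigD1 p) /=; last by rewrite eq_sym.
  by rewrite subrr mul0r !mulr0.
have nz i : c 0 i != 0 /\ al + be * t i != 0.
  have : c 0 i * (al + be * t i) != 0 by rewrite cE.
  by rewrite mulf_eq0 negb_or => /andP[].
have [be0|be0] := eqVneq be 0.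
  have al0 : al != 0 by have := (nz ord0).2; rewrite be0 mul0r addr0.
  exists al^-1, 0, 1; split; rewrite ?invr_eq0 //.
    by rewrite xpair_eqE oner_eq0 andbF.
  rewrite veronese01_node_curve; apply/rowP => i; rewrite mxE -cE be0 mul0r addr0.
  by field.
pose x := - al / be.
have xt i : x - t i != 0.
  apply: contraNneq (nz i).2 => E; have -> : al + be * t i = - be * (x - t i).
    by rewrite /x; field.
  by rewrite E mulr0.
pose P := \prod_j (x - t j).
have P0 : P != 0 by apply/prodf_neq0.
exists (- (be * P)^-1), 1, x; split.
- by rewrite oppr_eq0 invr_eq0 mulf_neq0.
- by rewrite xpair_eqE oner_eq0.
apply/rowP => i; rewrite mxE veronese_node_curve horner_node_poly -cE.
have PE : P = (x - t i) * \prod_(j | j != i) (x - t j) by rewrite /P (bigD1 i).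
rewrite PE; rewrite PE in P0.
move: (xt i) P0; set y := \prod_(j | _) _ => xi; rewrite mulf_eq0 negb_or => /andP[_ y0].
have -> : al + be * t i = - be * (x - t i) by rewrite /x; field.
by field; rewrite be0 y0 xi.
Qed.

End NormalCurve.

(** * The alternative between a normal curve and two linear spaces *)

Section Castelnuovo.
Variables (K : fieldType) (n : nat).
Local Notation N := n.+1.
Implicit Types (a s : 'M[K]_N) (c d : 'rV[K]_N) (X : seq 'rV[K]_N).

Definition cyclic_rel s (t : 'I_N -> K) := forall p q r,
  t r * (s q r - s p r) + t p * (s r p - s q p) + t q * (s p q - s r q) = 0.

(** Constants solve the relation because [s] is symmetric. So an affine function of [t] can be
    subtracted from [u] to get a solution [e] vanishing at [p] and [q]; a nonzero value of [e] would
    force [s p r = s q r]. *)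
Lemma cyclic_rel_affine s t u : (forall p q, s p q = s q p) ->
  nontrivial_frame s -> injective t -> cyclic_rel s t -> cyclic_rel s u ->
  exists al be, forall i, u i = al + be * t i.
Proof.
move=> sS [p [q [r [pr qr spq]]]] t_inj ts us.
have pq : p != q by apply: contraNneq spq => ->.
have tpq : t p - t q != 0 by rewrite subr_eq0 (inj_eq t_inj).
pose be := (u p - u q) / (t p - t q); pose al := u p - be * t p.
exists al, be; pose e i := u i - al - be * t i.
have ep : e p = 0 by rewrite /e /al; ring.
have eq : e q = 0 by rewrite /e /al /be; field.
have es : cyclic_rel s e.
  move=> x y z.
  have := us x y z; have := ts x y z; rewrite /e (sS z y) (sS z x) (sS y x).
  set T := (X in X = 0) => tE; set U := (X in X = 0) => uE.
  by transitivity (U - be * T); [rewrite /U /T; ring | rewrite tE uE mulr0 subr0].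
suff e0 : forall i, e i = 0.
  by move=> i; apply/eqP; rewrite -subr_eq0 opprD addrA; apply/eqP; apply: e0.
clearbody e.
have er : e r = 0.
  have := es p q r; rewrite ep eq !mul0r !addr0 => /eqP.
  by rewrite mulf_eq0 subr_eq0 [s q r == _]eq_sym (negbTE spq) orbF => /eqP.
(* In a triple one of whose three coefficients vanishes they all do, since they
   have sum zero and the nodes are distinct. *)
have triple x y z : x != y -> s y z = s x z -> s z x = s y x.
  move=> xy E; have := ts x y z; rewrite E subrr mulr0 add0r.
  rewrite (sS z y) E (sS x y) (sS z x) => H; apply/eqP; rewrite -subr_eq0.
  have : (t x - t y) * (s x z - s y x) = 0 by rewrite -H; ring.
  by move/eqP; rewrite mulf_eq0 (subr_eq0 (t x)) (inj_eq t_inj) (negbTE xy).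
move=> i.
have step x y : e x = 0 -> e y = 0 -> e i != 0 -> s y i = s x i.
  move=> ex ey ei; have := es x y i; rewrite ex ey !mul0r !addr0 => /eqP.
  by rewrite mulf_eq0 (negbTE ei) subr_eq0 => /eqP.
apply/eqP; apply: contraNT spq => ei.
have Epr : s i p = s r p by apply: triple pr (step _ _ ep er ei).
have Eqr : s i q = s r q by apply: triple qr (step _ _ eq er ei).
rewrite [s p r]sS [s q r]sS -Epr -Eqr [s i p]sS [s i q]sS.
by rewrite (step p q).
Qed.

(** The relation at two indices in the support and one outside shows that the columns outside the
    support are constant on it. *)
Lemma supp_full_or_point a c : compatible a c -> c != 0 ->
  (forall S, col_constant a S -> (1 < #|S|)%N -> S = setT) ->
  (exists p, forall i, i != p -> c 0 i = 0) \/ (forall i, c 0 i != 0).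
Proof.
move=> /compatibleP rel c0 noS; pose S := [set i | c 0 i != 0].
have aS : col_constant a S.
  apply/col_constantP => r p q; rewrite !inE negbK => /eqP cr cp cq.
  have := rel p q r; rewrite cr !(mulr0, mul0r) !addr0 => /eqP.
  by rewrite !mulf_eq0 (negbTE cp) (negbTE cq) subr_eq0 => /eqP.
have [/(noS _ aS) ST|S1] := ltnP 1 #|S|.
  by right=> i; have := in_setT i; rewrite -ST inE.
left; have [S0|[p pS]] := set_0Vmem S.
  case/eqP: c0; apply/rowP => i; rewrite mxE; apply/eqP; apply: contraT => ci.
  by have := in_set0 i; rewrite -S0 inE ci.
exists p => i; apply: contraNeq => ci.
by apply/eqP/(card_le1_eqP S1); rewrite // inE.
Qed.

(** Without a proper column-constant set, every vector off the frame has no zero coordinate. One of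
    them, [d], acts as unit point, and a second one not proportional to [d] provides the nodes; the
    nodes [t0] serve when either is missing. *)
Lemma frame_normal_curve_or_planes a X (t0 : 'I_N -> K) : injective t0 ->
  (forall c, c \in X -> c != 0) -> (forall c, c \in X -> compatible a c) ->
  nontrivial_frame a -> on_normal_curve X \/ in_two_planes X.
Proof.
move=> t0_inj X0 Xa nta.
have [/existsP[S /and3P[aS cardS SnT]]|noS0] := boolP [exists S : {set 'I_N},
    [&& col_constant a S, (1 < #|S|)%N & S != setT]].
  by right; apply: col_constant_in_two_planes aS cardS SnT.
have noS S : col_constant a S -> (1 < #|S|)%N -> S = setT.
  move=> aS cardS; apply/eqP; move: noS0; rewrite negb_exists => /forallP/(_ S).
  by rewrite aS cardS negbK.
have Xp c cX := supp_full_or_point (Xa c cX) (X0 c cX) noS.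
left; pose full (c : 'rV[K]_N) := [forall i, c 0 i != 0].
have [/hasP[d dX /forallP d0]|nofull] := boolP (has full X); last first.
  apply: (on_node_curve (d := const_mx 1) t0_inj) => // [i|c cX _].
    by rewrite mxE oner_eq0.
  have [|cF] := Xp c cX; first by left.
  by have := hasPn nofull _ cX => /negP[]; apply/forallP.
pose b p q := a p q / d 0 q.
(* The relations of [d] give [b p q - b q p = f q - f p] with [f q = b ord0 q - b q ord0];
   subtracting [f q] from column [q] makes the matrix symmetric. *)
pose s : 'M[K]_N := \matrix_(p, q) (b p q - (b ord0 q - b q ord0)).
have sS p q : s p q = s q p.
  have /compatibleP/(_ p q ord0) H := Xa _ dX.
  rewrite !mxE; apply/eqP; rewrite -subr_eq0; apply/eqP.
  rewrite -[RHS](mul0r (d 0 p * d 0 q * d 0 ord0)^-1) -H /b.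
  by field; rewrite !d0.
have sE p q r : s q r - s p r = (a q r - a p r) / d 0 r.
  by rewrite !mxE /b; field; rewrite ?d0.
pose tc (c : 'rV[K]_N) i := d 0 i / c 0 i.
have tcs c : c \in X -> (forall i, c 0 i != 0) -> cyclic_rel s (tc c).
  move=> cX c0 p q r; rewrite !sE /tc; have /compatibleP/(_ p q r) H := Xa _ cX.
  rewrite -[RHS](mul0r (c 0 p * c 0 q * c 0 r)^-1) -H.
  by field; rewrite !d0 !c0.
have tcI c : c \in X -> (forall i, c 0 i != 0) ->
    injective (tc c) \/ forall i j, tc c i = tc c j.
  move=> cX c0; have rel := tcs _ cX c0.
  have [/injectiveP|] := boolP (injectiveb (tc c)); [by left|right].
  have [p [q pq tpq]] : exists p, exists2 q, p != q & tc c p = tc c q.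
    by apply/injectivePn.
  (* A level set of [tc c] is column-constant, so with two elements it is everything. *)
  pose S := [set i | tc c i == tc c p].
  have aS : col_constant a S.
    apply/col_constantP => r x y; rewrite !inE => tr /eqP tx /eqP ty.
    have := rel x y r; rewrite tx ty (sS x y) (sS r x) (sS r y) => H.
    have {}H : (tc c r - tc c p) * (s y r - s x r) = 0 by rewrite -H; ring.
    move/eqP: H; rewrite mulf_eq0 subr_eq0 (negbTE tr) sE mulf_eq0 invr_eq0.
    by rewrite (negbTE (d0 r)) orbF subr_eq0 => /eqP.
  have ST : S = setT.
    apply: noS => //; apply/card_gt1P; exists p, q; split=> //.
      by rewrite inE.
    by rewrite inE -tpq.
  have E k : tc c k = tc c p by have := in_setT k; rewrite -ST inE => /eqP.
  by move=> x y; rewrite !E.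
have [/hasP[c1 c1X /andP[/forallP c10 nc1]]|noc1] := boolP (has (fun c =>
    full c && [exists i, exists j, tc c i != tc c j]) X); last first.
  (* Every full vector is now a multiple of [d], so any curve through the frame and [d] will do. *)
  apply: (on_node_curve t0_inj d0) => // c cX _.
  have [|c0] := Xp c cX; [by left|right].
  exists (tc c ord0), 0 => i; rewrite mul0r addr0.
  suff -> : tc c ord0 = tc c i by rewrite /tc; field; rewrite c0.
  apply/eqP; have := hasPn noc1 _ cX; rewrite negb_and => /orP[/negP[]|].
    by apply/forallP.
  by rewrite negb_exists => /forallP/(_ ord0); rewrite negb_exists
     => /forallP/(_ i); rewrite negbK.
have t_inj : injective (tc c1).
  have [//|E] := tcI _ c1X c10.
  by case/existsP: nc1 => i /existsP[j]; rewrite (E i j) eqxx.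
apply: (on_node_curve t_inj d0) => // c cX _.
have [|c0] := Xp c cX; [by left|right].
have [|al [be E]] := cyclic_rel_affine sS _ t_inj (tcs _ c1X c10) (tcs _ cX c0).
  have [p [q [r [pr qr apq]]]] := nta; exists p, q, r; split=> //.
  rewrite -subr_eq0 sE mulf_neq0 ?invr_eq0 // subr_eq0 //.
by exists al, be => i; rewrite -E /tc; field; rewrite c0.
Qed.

End Castelnuovo.

(** * From a Koszul class to the position of the points *)

Section KoszulClass.
Variables (K : fieldType) (n : nat).
Local Notation N := n.+1.
Implicit Types (X : {fset pspace K n}) (B : 'I_N -> 'M[K]_N) (v w x : 'rV[K]_N).

(* The condition on the diagonals matters only in characteristic 2. *)
Definition koszul_class X B : Prop :=
  [/\ forall i, (B i)^T = - B i, forall i p, B i p p = 0,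
      forall P v, P \in X -> v \in val P ->
        forall p q r, wedge3 v (lin_form B v) p q r = 0
    & ~ exists w, forall x, lin_form B x = wedge x w].

Lemma wedgeZl k v w : wedge (k *: v) w = k *: wedge v w.
Proof. by apply/matrixP => p q; rewrite !mxE; ring. Qed.

Lemma wedgeZr k v w : wedge v (k *: w) = k *: wedge v w.
Proof. by apply/matrixP => p q; rewrite !mxE; ring. Qed.

Lemma wedgeDl v v' w : wedge (v + v') w = wedge v w + wedge v' w.
Proof. by apply/matrixP => p q; rewrite !mxE; ring. Qed.

Lemma wedgevv v : wedge v v = 0.
Proof. by apply/matrixP => p q; rewrite !mxE; ring. Qed.

Lemma wedge_diag v w p : wedge v w p p = 0.
Proof. by rewrite mxE; ring. Qed.

Lemma wedgeT v w : (wedge v w)^T = - wedge v w.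
Proof. by apply/matrixP => p q; rewrite !mxE; ring. Qed.

Lemma lin_formT B x : (forall i, (B i)^T = - B i) -> (lin_form B x)^T = - lin_form B x.
Proof.
move=> BT; apply/matrixP => p q; rewrite !mxE !summxE -sumrN.
apply: eq_bigr => i _; have /matrixP/(_ p q) := BT i; rewrite !mxE => ->.
by rewrite mulrN.
Qed.

Lemma pspace_vpick (P : pspace K n) : vpick (val P) != 0 /\ val P = <[vpick (val P)]>%VS.
Proof.
have dP : \dim (val P) = 1%N := eqP (valP P).
have v0 : vpick (val P) != 0 by rewrite vpick0 -dimv_eq0 dP.
split=> //; apply/esym/eqP; rewrite eqEdim dP dim_vline v0 andbT.
by rewrite -memvE memv_pick.
Qed.

Lemma spanning_frame X : spanning X ->
  exists2 E : 'M[K]_N, E \in unitmx &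
    forall i, exists2 P, P \in X & row i E = vpick (val P).
Proof.
move=> spX; pose s := [seq vpick (val P) | P <- X].
have ss : (<<s>> = fullv)%VS.
  rewrite -spX span_def big_map; apply: eq_bigr => P _.
  by rewrite -(pspace_vpick P).2.
pose A : 'M[K]_(size s, N) := \matrix_i s`_i.
have fA : row_full A.
  rewrite -sub1mx; apply/row_subP => i; apply/submxP.
  have /coord_span -> : row i 1%:M \in <<in_tuple s>>%VS by rewrite ss memvf.
  exists (\row_j coord (in_tuple s) j (row i 1%:M)).
  rewrite mulmx_sum_row; apply: eq_bigr => j _; rewrite rowK mxE.
  by congr (_ *: _).
exists (rowsub (fullrankfun fA) A); first exact: fullrowsub_unit.
move=> i; set j := fullrankfun fA i.
have /mapP[P PX E] : s`_j \in s by rewrite mem_nth.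
by exists P => //; rewrite -E row_rowsub rowK.
Qed.

(** The frame vectors lie on lines of [X], so their bivectors are divisible by them and the
    quotients give [a]. If each column were constant off the diagonal, these constants would form a
    trivializing [w]. *)
Lemma koszul_class_frame X B (E : 'M[K]_N) : (1 < n)%N ->
  koszul_class X B -> E \in unitmx ->
  (forall i, exists2 P, P \in X & row i E = vpick (val P)) ->
  exists a, nontrivial_frame a /\
    forall c, c \in [seq vpick (val P) *m invmx E | P <- X] -> compatible a c.
Proof.
move=> n1 [BT _ BX Bnt] uE EX.
have /fin_all_exists[V BE] i : exists w, lin_form B (row i E) = wedge (row i E) w.
  have [P PX ->] := EX i; apply: wedge3_eq0 (lin_formT _ BT) _.
    exact: (pspace_vpick P).1.
  exact: (BX _ _ PX (memv_pick _)).
pose Vm := \matrix_i V i.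
have BV i : lin_form B (row i E) = wedge (row i E) (row i Vm) by rewrite BE rowK.
exists (Vm *m invmx E); split; last first.
  move=> _ /mapP[P PX ->]; apply: (compatible_frame uE BV); rewrite mulmxKV //.
  exact: (BX _ _ PX (memv_pick _)).
set a := Vm *m invmx E.
have [/existsP[p /existsP[q /existsP[r /and3P[*]]]]|nt] := boolP [exists p, exists q,
    exists r, [&& p != r, q != r & a p r != a q r]]; first by exists p, q, r.
have {}nt p q r : p != r -> q != r -> a p r = a q r.
  move=> pr qr; apply/eqP; move: nt; rewrite negb_exists => /forallP/(_ p).
  rewrite negb_exists => /forallP/(_ q); rewrite negb_exists => /forallP/(_ r).
  by rewrite pr qr negbK.
case: Bnt; pose w : 'rV[K]_N := \row_r a (if r == ord0 then ord_max else ord0) r.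
have aw p r : p != r -> a p r = w 0 r.
  move=> pr; rewrite [RHS]mxE; apply: nt pr _.
  have [->|] := eqVneq r ord0; last by rewrite eq_sym.
  by rewrite -val_eqE /= -lt0n ltnW.
exists (w *m E) => x.
rewrite -[x](mulmxKV uE) (lin_form_frame _ uE BV) wedge_mulmx; congr (_ *m _ *m _).
apply/matrixP => p q; rewrite [LHS]mxE [RHS]mxE.
have [->|pq] := eqVneq p q; first by rewrite !subrr.
by rewrite aw // aw // eq_sym.
Qed.

Lemma vspace_enlarge (U : {vspace 'rV[K]_N}) m : (\dim U <= m)%N -> (m <= N)%N ->
  exists2 U' : {vspace 'rV[K]_N}, (U <= U')%VS & \dim U' = m.
Proof.
have dN : \dim {: 'rV[K]_N} = N by rewrite dimvf /dim /= mul1n.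
elim: m => [|m IH] Um mN.
  by exists U => //; apply/eqP; rewrite -leqn0.
have [{}Um|] := leqP (\dim U) m; last first.
  by exists U => //; apply/eqP; rewrite eqn_leq Um.
have [U' UU' dU'] := IH Um (ltnW mN).
have : ~~ (fullv <= U')%VS.
  by apply/negP => /dimvS; rewrite dN dU' leqNgt mN.
case/subvPn => v _ vU'; exists (U' + <[v]>)%VS.
  exact: subv_trans UU' (addvSl _ _).
have v0 : v != 0 by apply: contraNneq vU' => ->; rewrite mem0v.
rewrite dimv_disjoint_sum ?dU' ?dim_vline ?v0 ?addn1 //.
apply/eqP; rewrite -subv0; apply/subvP => y; rewrite memv_cap => /andP[yU' /vlineP[k yE]].
rewrite memv0; apply: contraNT vU' => y0.
have k0 : k != 0 by apply: contraNneq y0 => k0; rewrite yE k0 scale0r.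
by rewrite -(scalerK k0 v) -yE rpredZ.
Qed.

Lemma in_two_planes_linear_union X : (1 < n)%N ->
  in_two_planes [seq vpick (val P) | P <- X] ->
  exists k r : nat,
    [/\ (0 < k)%N, (0 < r)%N, (k + r)%N = n & on_linear_union X k r].
Proof.
move=> n1 [L [M [dL dM dLM H]]].
(* The dimension of [L] is raised to at least 2, since [k] has to be positive even if [L] is a point
   or zero. *)
pose k := (maxn (\dim L) 2).-1.
have k1 : k.+1 = maxn (\dim L) 2 by rewrite prednK // leq_max orbT.
have kn : (k < n)%N by rewrite k1 geq_max n1 andbT -ltnS.
have [L' LL' dL'] : exists2 U : {vspace _}, (L <= U)%VS & \dim U = k.+1.
  by apply: vspace_enlarge; [rewrite k1 leq_maxl | rewrite ltnS ltnW].
have [M' MM' dM'] : exists2 U : {vspace _}, (M <= U)%VS & \dim U = (n - k).+1.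
  apply: vspace_enlarge; last by rewrite ltnS leq_subr.
  by move: kn k1 dM dLM; clearbody k; lia.
exists k, (n - k)%N; split; rewrite ?subn_gt0 ?subnKC ?(ltnW kn) //.
  by rewrite -ltnS k1 leq_maxr.
exists L', M'; split=> // P PX; rewrite (pspace_vpick P).2 -!memvE.
have [Hv|Hv] := H (vpick (val P)) (map_f _ PX); [left|right].
  exact: subvP LL' _ Hv.
exact: subvP MM' _ Hv.
Qed.

Lemma on_normal_curve_rational X (E : 'M[K]_N) : E \in unitmx ->
  on_normal_curve [seq vpick (val P) *m invmx E | P <- X] ->
  on_rational_normal_curve X.
Proof.
move=> uE [g ug H]; exists (g *m E); first by rewrite unitmx_mul ug.
move=> P PX; have [k [s [t [k0 st E']]]] := H _ (map_f _ PX).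
exists s, t; split=> //; rewrite (pspace_vpick P).2 mulmxA.
have -> : vpick (val P) = k *: (veronese n s t *m g *m E).
  by rewrite scalemxAl -E' mulmxKV.
apply/eqP; rewrite eqEsubv -!memvE; apply/andP; split; first exact: rpredZ (memv_line _).
by apply/vlineP; exists k^-1; rewrite scalerK.
Qed.

End KoszulClass.

(** * From the position of the points to a Koszul class *)

Section KoszulClassConverse.
Variables (K : fieldType) (n : nat).
Local Notation N := n.+1.
Implicit Types (X : {fset pspace K n}) (B : 'I_N -> 'M[K]_N) (v w x : 'rV[K]_N).

Definition shift_mx : 'M[K]_N := \matrix_(i, j) (j == i.+1 :> nat)%:R.

(** For [v] on the curve and its shift [v'], [t v' = s (v - v_0 e_0)], so [e_0 /\ v'] is divisible
    by [v] if [t] is nonzero. If [t = 0], [v] is a multiple of [e_0]. *)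
Lemma veronese_shift s t : (0 < n)%N -> exists w,
  wedge (delta_mx 0 ord0) (veronese n s t *m shift_mx) = wedge (veronese n s t) w.
Proof.
move=> n0; set v := veronese n s t; pose e0 : 'rV[K]_N := delta_mx 0 ord0.
have vS0 : (v *m shift_mx) 0 ord0 = 0.
  by rewrite mxE big1 // => i _; rewrite !mxE mulr0.
have vS (j j' : 'I_N) : j = j'.+1 :> nat -> (v *m shift_mx) 0 j = v 0 j'.
  move=> jj; rewrite mxE (bigD1 j') //= big1 ?addr0 => [|i ij].
    by rewrite [shift_mx _ _]mxE jj eqxx mulr1.
  by rewrite [shift_mx _ _]mxE jj eqSS eq_sym (inj_eq val_inj) (negbTE ij) mulr0.
have tvS : t *: (v *m shift_mx) = s *: (v - v 0 ord0 *: e0).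
  apply/rowP => j; rewrite [LHS]mxE.
  have [->|j0] := eqVneq j ord0.
    by rewrite vS0 !mxE !eqxx /=; ring.
  have jE : j = j.-1.+1 :> nat by move: j0; rewrite -val_eqE /=; lia.
  have ltj : (j.-1 < N)%N by have := ltn_ord j; lia.
  rewrite (vS j (Ordinal ltj) jE) !mxE /= (negbTE j0) mulr0 subr0.
  have -> : (n - j.-1 = (n - j).+1)%N by have := ltn_ord j; lia.
  by set m := (n - j)%N; rewrite [X in _ = _ * (_ * _ ^+ X)]jE !exprS; ring.
have [t0|t0] := eqVneq t 0.
  have vE : v = s ^+ n *: e0.
    apply/rowP => j; rewrite !mxE t0 expr0n /=.
    have [->|j0] := eqVneq j ord0; first by rewrite /= subn0.
    have -> : (j == 0 :> nat) = false by apply: negbTE; rewrite -val_eqE in j0.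
    by rewrite !mulr0.
  have [s0|s0] := eqVneq s 0.
    exists 0; have -> : v *m shift_mx = 0.
      by rewrite vE s0 expr0n eqn0Ngt n0 scale0r mul0mx.
    by apply/matrixP => p q; rewrite !mxE; ring.
  have sn : s ^+ n != 0 by rewrite expf_neq0.
  exists ((s ^+ n)^-1 *: (v *m shift_mx)).
  rewrite [in RHS]wedgeZr [in X in _ = _ *: wedge X _]vE wedgeZl scalerA.
  by rewrite mulVf // scale1r.
exists (- (s / t) *: e0).
have -> : v *m shift_mx = (s / t) *: (v - v 0 ord0 *: e0).
  by apply: (scalerI t0); rewrite tvS scalerA; congr (_ *: _); field.
by apply/matrixP => p q; rewrite !mxE; ring.
Qed.

Lemma delta_frame_form (M : 'M[K]_N) v0 x :
  lin_form (fun i => wedge v0 (delta_mx 0 i *m M)) x = wedge v0 (x *m M).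
Proof.
rewrite {2}[x]row_sum_delta mulmx_suml; apply/matrixP => p q.
rewrite !mxE summxE !summxE !mulr_sumr -sumrB; apply: eq_bigr => i _.
by rewrite -scalemxAl !mxE; ring.
Qed.

Lemma rational_normal_curve_class X : (1 < n)%N ->
  on_rational_normal_curve X -> exists B, koszul_class X B.
Proof.
move=> n1 [g ug H]; pose e0 : 'rV[K]_N := delta_mx 0 ord0.
pose M := invmx g *m shift_mx *m g.
exists (fun i => wedge (e0 *m g) (delta_mx 0 i *m M)); split.
- by move=> i; rewrite wedgeT.
- by move=> i p; rewrite wedge_diag.
- move=> P v PX vP p q r; have [s [t [_ PE]]] := H _ PX.
  move: vP; rewrite PE => /vlineP[k ->].
  have [w E] := veronese_shift s t (ltnW n1).
  rewrite delta_frame_form // -scalemxAl /M mulmxA mulmxA mulmxK // wedgeZr.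
  by rewrite wedge_mulmx E -wedge_mulmx -wedgeZl wedge3_wedge.
case=> w E; pose u := w *m invmx g.
have {}E y : wedge e0 (y *m shift_mx) = wedge y u.
  have := E (y *m g); rewrite delta_frame_form // /M !mulmxA mulmxK //.
  rewrite -[w](mulmxKV ug) !wedge_mulmx -/u => /eqP.
  rewrite -subr_eq0 -mulmxBl -mulmxBr => /eqP /(frame_map_conj_eq0 ug) /eqP.
  by rewrite subr_eq0 => /eqP.
(* Coordinate 1 of a trivializing [u] would be 0, by the last basis vector, whose shift is zero, and
   also 1, by [e_0], whose shift is [e_1]. The first uses that index 1 is not the last one. *)
pose i1 : 'I_N := inord 1.
have i1E : i1 = 1%N :> nat by rewrite inordK // ltnS ltnW.
clearbody u.
have i1m : (i1 == ord_max) = false by rewrite -val_eqE /= i1E ltn_eqF.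
have i10 : (i1 == ord0) = false by rewrite -val_eqE /= i1E.
have := E (delta_mx 0 ord_max); rewrite -rowE.
have -> : row ord_max shift_mx = 0.
  by apply/rowP => j; rewrite !mxE /= ltn_eqF ?ltn_ord.
move/matrixP/(_ ord_max i1); rewrite !mxE !eqxx /= i1m i10.
rewrite !mulr0 !mul0r subrr mul1r subr0 => u1.
have := E e0; rewrite -rowE => /matrixP/(_ ord0 i1).
rewrite !mxE !eqxx /= i1E i10 !mul1r !mul0r !subr0 -u1 => /eqP.
by rewrite oner_eq0.
Qed.

Lemma wedge_eq0_vspace (U : {vspace 'rV[K]_N}) w : (1 < \dim U)%N ->
  (forall x, x \in U -> wedge x w = 0) -> w = 0.
Proof.
move=> dU H; apply/rowP => p; rewrite mxE; apply/eqP; apply: contraLR dU => wp.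
rewrite -leqNgt (leq_trans _ (_ : (\dim <[w]> <= 1)%N)) //; last first.
  by rewrite dim_vline; case: (w == 0).
apply: dimvS; apply/subvP => x /H/matrixP/(_ p) xw; apply/vlineP.
exists (x 0 p / w 0 p); apply/rowP => q; have := xw q; rewrite !mxE => /eqP.
by rewrite subr_eq0 => /eqP E; rewrite mulrAC E; field.
Qed.

(** The spaces span everything and so meet in a line [<z>]. The class is [x |-> pi(x) /\ z] with
    [pi] a projection into [L] along [M]: it is [x /\ z] on [L] and zero on [M]. No single [w] gives
    both, since the spaces have dimension at least 2. *)
Lemma linear_union_class X k r : spanning X -> (0 < k)%N -> (0 < r)%N ->
  (k + r)%N = n -> on_linear_union X k r -> exists B, koszul_class X B.
Proof.
move=> spX k0 r0 kr [L [M [dL dM H]]].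
have LM : (L + M)%VS = fullv.
  apply/eqP; rewrite eqEsubv subvf -spX /= big_seq.
  apply: (big_ind (fun U => (U <= L + M)%VS)) => [|U V|P PX].
  - exact: sub0v.
  - by rewrite subv_add => ->.
  - by have [PL|PM] := H _ PX; [apply: subv_trans PL (addvSl _ _) |
      apply: subv_trans PM (addvSr _ _)].
have dLM : \dim (L :&: M) = 1%N.
  have := dimv_sum_cap L M; rewrite LM dimvf /dim /= dL dM; lia.
pose z := vpick (L :&: M).
have zLM : z \in (L :&: M)%VS := memv_pick _.
have z0 : z != 0 by rewrite vpick0 -dimv_eq0 dLM.
have LMz x : x \in L -> x \in M -> exists h, x = h *: z.
  move=> xL xM; apply/vlineP; suff <- : (L :&: M)%VS = <[z]>%VS by rewrite memv_cap xL.
  by apply/esym/eqP; rewrite eqEdim dLM dim_vline z0 -memvE zLM.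
pose pi := addv_pi1 L M.
have pi12 x : pi x + addv_pi2 L M x = x by rewrite addv_pi1_pi2 // LM memvf.
have piM x : x \in M -> pi x = 0.
  move=> xM; have := pi12 x; rewrite addv_pi2_id // => /eqP.
  by rewrite -subr_eq0 addrK => /eqP.
have piL x : x \in L -> wedge (pi x) z = wedge x z.
  move=> xL; have [||h hE] := LMz (addv_pi2 L M x); last 2 first.
  - exact: memv_pi2.
  - by rewrite -{2}[x]pi12 wedgeDl hE wedgeZl wedgevv scaler0 addr0.
  have -> : addv_pi2 L M x = x - pi x by rewrite -{2}[x]pi12 addrC addKr.
  by rewrite rpredB // memv_pi1.
have formE x : lin_form (fun i => wedge (pi (delta_mx 0 i)) z) x = wedge (pi x) z.
  rewrite {2}[x]row_sum_delta linear_sum /=; apply/matrixP => p q.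
  rewrite !mxE !summxE !mulr_suml -sumrB; apply: eq_bigr => i _.
  by rewrite linearZ !mxE; ring.
exists (fun i => wedge (pi (delta_mx 0 i)) z); split.
- by move=> i; rewrite wedgeT.
- by move=> i p; rewrite wedge_diag.
- move=> P v PX vP p q s; rewrite formE; have [PL|PM] := H _ PX.
    by rewrite piL ?wedge3_wedge // (subvP PL).
  rewrite piM ?(subvP PM) // /wedge3 !mxE; ring.
case=> w E; have {}E x : wedge (pi x) z = wedge x w by rewrite -formE E.
have w0 : w = 0.
  apply: (@wedge_eq0_vspace M); first by rewrite dM.
  by move=> x xM; rewrite -E piM //; apply/matrixP => p q; rewrite !mxE; ring.
case/eqP: z0; apply: (@wedge_eq0_vspace L); first by rewrite dL.
by move=> x xL; rewrite -piL // E w0; apply/matrixP => p q; rewrite !mxE; ring.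
Qed.

End KoszulClassConverse.

(** A polynomial with prescribed roots has a further non-root, so distinct elements are added one at
    a time. *)
Lemma closed_field_nodes (K : closedFieldType) N :
  exists t : 'I_N -> K, injective t.
Proof.
suff [s us ss] : exists2 s : seq K, uniq s & size s = N.
  exists (fun i => s`_i) => i j /eqP; rewrite nth_uniq ?ss ?ltn_ord //.
  by move/eqP/val_inj.
elim: N => [|N [s us ss]]; first by exists [::].
have /closed_nonrootP[x] : \prod_(y <- s) ('X - y%:P) != 0.
  exact/monic_neq0/monic_prod_XsubC.
rewrite root_prod_XsubC => xs; exists (x :: s); first by rewrite /= xs.
by rewrite /= ss.
Qed.

Theorem koszul_class_iff (K : closedFieldType) n (X : {fset pspace K n}) :
  (1 < n)%N -> spanning X ->
  (exists B, koszul_class X B) <->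
  on_rational_normal_curve X \/
  exists k r : nat,
    [/\ (0 < k)%N, (0 < r)%N, (k + r)%N = n & on_linear_union X k r].
Proof.
move=> n1 spX; split=> [[B XB]|[/rational_normal_curve_class|]]; last 2 first.
- exact.
- by case=> k [r [k0 r0 kr H]]; apply: linear_union_class spX k0 r0 kr H.
have [E uE EX] := spanning_frame spX.
have [a [nta Xa]] := koszul_class_frame n1 XB uE EX.
have [t t_inj] := closed_field_nodes K n.+1.
have [||H] := frame_normal_curve_or_planes t_inj _ Xa nta.
- move=> _ /mapP[P PX ->]; apply: contraNneq (pspace_vpick P).1 => E0.
  by rewrite -[vpick _](mulmxKV uE) E0 mul0mx.
- by move/(on_normal_curve_rational uE); left.
right; apply: in_two_planes_linear_union n1 _.
apply: (in_two_planes_mulmx (E := invmx E)); first by rewrite unitmx_inv.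
by rewrite -map_comp.
Qed.

(** * Homogeneous parts and the Koszul complex *)

Section PolynomialParts.
Variables (K : fieldType) (N : nat).
Local Notation R := {mpoly K[N]}.
Implicit Types (p q : R) (m : 'X_{1..N}) (d e : int).

Definition hpart d p : R :=
  \sum_(m <- msupp p | (mdeg m)%:Z == d) p@_m *: 'X_[m].

Lemma mcoeff_sum_msupp p (P : pred 'X_{1..N}) (f : 'X_{1..N} -> 'X_{1..N}) k m :
  f m = k -> (forall m', P m' -> f m' = k -> m' = m) ->
  (\sum_(m' <- msupp p | P m') p@_m' *: 'X_[f m'] : R)@_k = if P m then p@_m else 0.
Proof.
move=> fm finj; rewrite raddf_sum /= big_mkcond /=.
have E m' : (if P m' then (p@_m' *: 'X_[f m'] : R)@_k else 0)
    = if m' == m then (if P m then p@_m else 0) else 0.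
  case: eqVneq => [->|mm]; first by rewrite mcoeffZ mcoeffX fm eqxx mulr1.
  case: ifP => // Pm; rewrite mcoeffZ mcoeffX.
  by case: eqP => [/(finj _ Pm)/eqP|_]; rewrite ?(negbTE mm) ?mulr0.
rewrite (eq_bigr _ (fun m' _ => E m')) -big_mkcond /=.
have [mp|mp] := boolP (m \in msupp p).
  by rewrite -big_filter filter_pred1_uniq ?msupp_uniq // big_seq1.
rewrite (memN_msupp_eq0 mp) if_same big1_seq // => m' /andP[/eqP ->]; rewrite (negbTE mp).
Qed.

Lemma mcoeff_hpart d p m : (hpart d p)@_m = if (mdeg m)%:Z == d then p@_m else 0.
Proof. by rewrite (@mcoeff_sum_msupp _ _ id m m). Qed.

Lemma hpartP d p : homog_deg d p <-> hpart d p = p.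
Proof.
split=> [Hp|H m].
  apply/mpolyP => m; rewrite mcoeff_hpart; case: eqP => // md.
  by apply/esym/eqP; rewrite mcoeff_eq0; apply/negP => /Hp.
by rewrite -H mcoeff_msupp mcoeff_hpart; case: ifP => [/eqP//|]; rewrite eqxx.
Qed.

Lemma hpart_is_zmod_morphism d : zmod_morphism (hpart d).
Proof.
move=> p q; apply/mpolyP => m; rewrite mcoeffB !mcoeff_hpart mcoeffB.
by case: ifP => // _; rewrite subr0.
Qed.
HB.instance Definition _ d :=
  GRing.isZmodMorphism.Build R R (hpart d) (hpart_is_zmod_morphism d).

Lemma hpart_idem d p : hpart d (hpart d p) = hpart d p.
Proof.
apply/hpartP => m; rewrite mcoeff_msupp mcoeff_hpart.
by case: ifP => [/eqP//|]; rewrite eqxx.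
Qed.

Lemma hpartZ d (c : K) p : hpart d (c *: p) = c *: hpart d p.
Proof.
by apply/mpolyP => m; rewrite !(mcoeff_hpart, mcoeffZ); case: ifP; rewrite ?mulr0.
Qed.

Lemma mcoeffMX_if p m k :
  (p * 'X_[m])@_k = if (m <= k)%MM then p@_(k - m) else 0.
Proof.
case: ifP => mk; first by rewrite -[in LHS](submK mk) addmC mcoeffMX.
apply/eqP; rewrite mcoeff_eq0 (perm_mem (msuppMX p m)); apply/negP.
by case/mapP => m' _ kE; move: mk; rewrite kE lem_addr.
Qed.

Lemma hpartMX d p m : hpart (d + (mdeg m)%:Z) (p * 'X_[m]) = hpart d p * 'X_[m].
Proof.
apply/mpolyP => k; rewrite mcoeff_hpart !mcoeffMX_if mcoeff_hpart.
have [mk|_] := boolP (m <= k)%MM; last by rewrite if_same.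
by rewrite -{1}(submK mk) mdegD PoszD (inj_eq (addIr _)).
Qed.

Lemma hpartM d e p q : homog_deg e q -> hpart (d + e) (p * q) = hpart d p * q.
Proof.
move=> qe; rewrite [q]mpolyE !mulr_sumr raddf_sum /=.
rewrite big_seq [RHS]big_seq; apply: eq_bigr => m /qe <-.
by rewrite -!scalerAr hpartZ hpartMX.
Qed.

Lemma hpartXM i d p : hpart (d + 1) ('X_i * p) = 'X_i * hpart d p.
Proof.
have -> : d + 1 = d + (mdeg (U_(i) : 'X_{1..N}))%:Z by rewrite mdeg1.
by rewrite ['X_i * p]mulrC hpartMX mulrC.
Qed.

(** A one-sided inverse of multiplication by [X_i] that commutes with the other variables; the
    Koszul homotopy is built from it. *)
Definition mdivX (i : 'I_N) p : R :=
  \sum_(m <- msupp p | (U_(i) <= m)%MM) p@_m *: 'X_[m - U_(i)].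

Lemma mcoeff_mdivX i p m : (mdivX i p)@_m = p@_(m + U_(i)).
Proof.
rewrite (@mcoeff_sum_msupp _ _ (fun m' => m' - U_(i))%MM m (m + U_(i))%MM).
- by rewrite lem_addl.
- by rewrite addmK.
- by move=> m' im <-; rewrite submK.
Qed.

Lemma mdivX_is_zmod_morphism i : zmod_morphism (mdivX i).
Proof. by move=> p q; apply/mpolyP => m; rewrite mcoeffB !mcoeff_mdivX mcoeffB. Qed.
HB.instance Definition _ i :=
  GRing.isZmodMorphism.Build R R (mdivX i) (mdivX_is_zmod_morphism i).

Lemma mdivXK i p : mdivX i ('X_i * p) = p.
Proof. by apply/mpolyP => m; rewrite mcoeff_mdivX mulrC addmC mcoeffMX. Qed.

Lemma mdivXM i j p : i != j -> mdivX i ('X_j * p) = 'X_j * mdivX i p.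
Proof.
move=> ij; apply/mpolyP => m; rewrite mcoeff_mdivX ['X_j * p]mulrC.
rewrite ['X_j * mdivX i p]mulrC !mcoeffMX_if.
rewrite !lep1mP mnmDE mnm1E (negbTE ij) addn0; case: ifP => // mj.
rewrite mcoeff_mdivX; congr (_@__); apply/mnmP => k.
rewrite !(mnmBE, mnmDE) !mnm1E.
have : ~~ ((i == k) && (j == k)) by apply: contra ij => /andP[/eqP-> /eqP->].
by case: (i == k); case: (j == k) => //= _; lia.
Qed.

End PolynomialParts.

(** * The Koszul complex and its homotopies *)

Section Koszul.
Variables (K : fieldType) (N : nat).
Local Notation R := {mpoly K[N]}.
Implicit Types (S T : {set 'I_N}) (i j : 'I_N).

Definition ksign i S : R := (-1) ^+ #|[set j in S | (j < i)%N]|.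

Lemma ksignK i S : ksign i S * ksign i S = 1.
Proof. by rewrite -expr2 sqrr_sign. Qed.

Lemma ksignD1 i j T : i \in T -> ksign j T = ksign j (T :\ i) * (-1) ^+ (i < j)%N.
Proof.
move=> iT; rewrite /ksign -exprD (cardsD1 i) !inE iT addnC; congr (_ ^+ (_ + _)).
by apply: eq_card => k; rewrite !inE andbA.
Qed.

Lemma ksign_swap i j T : i != j -> i \in T -> j \in T ->
  ksign i T * ksign j T = - (ksign i (T :\ j) * ksign j (T :\ i)).
Proof.
move=> ij iT jT; rewrite (ksignD1 _ jT) (ksignD1 _ iT).
move: ij; rewrite -val_eqE /=.
by case: ltngtP => // _ _; rewrite ?expr0 ?expr1; ring.
Qed.

Lemma ksign_swapD1 i j T : i != j -> i \in T -> j \in T ->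
  ksign i T * ksign j (T :\ i) = - (ksign j T * ksign i (T :\ j)).
Proof.
move=> ij iT jT; have E := ksign_swap ij iT jT.
have : (ksign i T * ksign j T) * (ksign j T * ksign j (T :\ i)) =
   - (ksign i (T :\ j) * ksign j (T :\ i)) * (ksign j T * ksign j (T :\ i)).
  by rewrite E.
have -> : ksign i T * ksign j T * (ksign j T * ksign j (T :\ i))
   = (ksign j T * ksign j T) * (ksign i T * ksign j (T :\ i)) by ring.
rewrite ksignK mul1r => ->.
have -> : - (ksign i (T :\ j) * ksign j (T :\ i)) * (ksign j T * ksign j (T :\ i))
   = - (ksign j T * ksign i (T :\ j)) * (ksign j (T :\ i) * ksign j (T :\ i)) by ring.
by rewrite ksignK mulr1.
Qed.

Section Coefficients.
Variable r : nat.
Implicit Types (f g e : {set 'I_N} -> 'rV[R]_r) (v w : 'rV[R]_r).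

Definition kdiff f S : 'rV[R]_r := \sum_(i in S) (ksign i S * 'X_i) *: f (S :\ i).

Lemma eq_kdiff f g S : (forall T, f T = g T) -> kdiff f S = kdiff g S.
Proof. by move=> fg; apply: eq_bigr => i _; rewrite fg. Qed.

Lemma kdiffD f g S : kdiff (fun T => f T + g T) S = kdiff f S + kdiff g S.
Proof. by rewrite -big_split; apply: eq_bigr => i _; rewrite scalerDr. Qed.

Lemma kdiffB f g S : kdiff (fun T => f T - g T) S = kdiff f S - kdiff g S.
Proof. by rewrite -sumrB; apply: eq_bigr => i _; rewrite scalerBr. Qed.

Lemma big_swap_antisym (F : 'I_N -> 'I_N -> 'rV[R]_r) S :
  (forall i j, i \in S -> j \in S -> i != j -> F i j = - F j i) ->
  \sum_(i in S) \sum_(j in S :\ i) F i j = 0.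
Proof.
move=> Fa.
transitivity (\sum_(i in S) \sum_(j in S) ((if (i < j)%N then F i j else 0) +
               (if (j < i)%N then F i j else 0))).
  apply: eq_bigr => i iS; rewrite (big_setD1 i iS) /= ltnn addr0 add0r.
  apply: eq_bigr => j; rewrite !inE -val_eqE /= => /andP[ji _].
  by case: ltngtP ji; rewrite ?addr0 ?add0r.
under eq_bigr => i _ do rewrite big_split /=.
rewrite big_split /= [X in _ + X]exchange_big -big_split big1 // => i iS /=.
rewrite -big_split big1 // => j jS /=; case: ifP => ij; last by rewrite addr0.
by rewrite (Fa i j) ?addNr //; apply: contraTneq ij => ->; rewrite ltnn.
Qed.

Lemma kdiff_kdiff f S : kdiff (kdiff f) S = 0.
Proof.
rewrite /kdiff; under eq_bigr => i _ do rewrite scaler_sumr.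
apply: big_swap_antisym => i j iS jS ij.
rewrite !scalerA -scaleNr setDDl setUC -setDDl; congr (_ *: _).
transitivity ((ksign i S * ksign j (S :\ i)) * ('X_i * 'X_j)); first by ring.
by rewrite ksign_swapD1 //; ring.
Qed.

Definition khom i f S : 'rV[R]_r :=
  if i \in S then 0 else ksign i (i |: S) *: map_mx (mdivX i) (f (i |: S)).

Lemma map_mdivX_scale i j v : i != j ->
  map_mx (mdivX i) ('X_j *: v) = 'X_j *: map_mx (mdivX i) v.
Proof. by move=> ij; apply/matrixP => a b; rewrite !mxE mdivXM. Qed.

Lemma map_mdivX_scaleX i v : map_mx (mdivX i) ('X_i *: v) = v.
Proof. by apply/matrixP => a b; rewrite !mxE mdivXK. Qed.

Lemma map_mdivX_sign i k v :
  map_mx (mdivX i) ((-1) ^+ k *: v) = (-1) ^+ k *: map_mx (mdivX i) v.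
Proof.
apply/matrixP => a b; rewrite !mxE -signr_odd.
by case: (odd k); rewrite !(expr0, expr1, mul1r, mulN1r, raddfN).
Qed.

(** Contraction with [e_i] and division by [X_i] invert the differential up to what the division
    loses: the terms with [i] in [S] whose monomials are free of [X_i]. *)
Lemma khom_homotopy i f S :
  kdiff (khom i f) S + khom i (kdiff f) S =
  if i \in S then 'X_i *: map_mx (mdivX i) (f S) else f S.
Proof.
rewrite {2}/khom; case: ifPn => iS.
  rewrite addr0 /kdiff (bigD1 i) //= big1 ?addr0 => [|j /andP[jS ji]]; last first.
    by rewrite /khom !inE iS eq_sym ji scaler0.
  rewrite /khom !inE eqxx /= setD1K // scalerA mulrAC ksignK mul1r //.
rewrite {2}/kdiff big_setU1 //= raddfD /= scalerDr addrCA.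
rewrite setU1K // -scalerA map_mdivX_sign scalerA ksignK scale1r map_mdivX_scaleX.
rewrite -[RHS]addr0; congr (_ + _).
rewrite raddf_sum scaler_sumr -big_split big1 // => j jS /=.
have ij : i != j by apply: contraNneq iS => ->.
rewrite /khom !inE (negbTE iS) andbF -!scalerA map_mdivX_sign map_mdivX_scale //.
have -> : (i |: S) :\ j = i |: (S :\ j).
  by apply/setP => k; rewrite !inE; case: (eqVneq k i) => [->|]; rewrite ?ij // andbC.
rewrite !scalerA -scalerDl.
have := @ksign_swap i j (i |: S) ij; rewrite !inE eqxx jS orbT => /(_ isT isT).
have -> : (i |: S) :\ j = i |: (S :\ j).
  by apply/setP => k; rewrite !inE; case: (eqVneq k i) => [->|]; rewrite ?ij // andbC.
rewrite setU1K // => E; rewrite -[RHS](scale0r (map_mx (mdivX i) (f (i |: S :\ j)))).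
congr (_ *: _); rewrite -[(-1) ^+ #|_|]/(ksign j (i |: S)) E.
by ring.
Qed.

Lemma mcoeff_rowB v w a (m : 'X_{1..N}) :
  ((v - w) 0 a)@_m = (v 0 a)@_m - (w 0 a)@_m.
Proof. by rewrite !mxE mcoeffB. Qed.

Lemma mcoeff_row_mdivX i v a (m : 'X_{1..N}) :
  (('X_i *: map_mx (mdivX i) v) 0 a)@_m = if m i != 0%N then (v 0 a)@_m else 0.
Proof.
rewrite !mxE mulrC mcoeffMX_if lep1mP; case: ifP => // mi.
by rewrite mcoeff_mdivX submK ?lep1mP.
Qed.

Lemma kdiff_coef0 f S a : (kdiff f S 0 a)@_0%MM = 0.
Proof.
rewrite /kdiff summxE raddf_sum big1 // => i _ /=.
by rewrite mxE -mulrA mulrCA mulrC mcoeffMX_if lep1mP mnm0E.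
Qed.

(** The only cohomology sits in the constants at [setT]. One homotopy per variable is applied in
    turn; the error left is supported on sets containing the treated indices and on monomials free
    of their variables, hence finally on the constant term at [setT]. *)
Lemma kdiff_exact f : (forall S, kdiff f S = 0) ->
  (forall a, (f setT 0 a)@_0%MM = 0) -> exists e, forall S, f S = kdiff e S.
Proof.
move=> f0 fT.
have partial (s : seq 'I_N) : exists e, forall S a (m : 'X_{1..N}) i,
    i \in s -> (i \notin S) || (m i != 0%N) -> ((f S - kdiff e S) 0 a)@_m = 0.
  elim: s => [|i s [e IH]]; first by exists f.
  pose g S := f S - kdiff e S.
  have g0 S : kdiff g S = 0.
    by rewrite kdiffB f0 kdiff_kdiff subrr.
  exists (fun S => e S + khom i g S) => S a m j.
  have -> : f S - kdiff (fun T => e T + khom i g T) S =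
      if i \in S then g S - 'X_i *: map_mx (mdivX i) (g S) else 0.
    have := khom_homotopy i g S; have -> : khom i (kdiff g) S = 0.
      rewrite /khom g0; case: ifP => // _.
      by apply/rowP => x; rewrite !mxE raddf0 mulr0.
    rewrite addr0 kdiffD opprD addrA -/(g S) => ->.
    by case: ifP; rewrite ?subrr.
  have gE : ((g S - 'X_i *: map_mx (mdivX i) (g S)) 0 a)@_m =
      if m i != 0%N then 0 else (g S 0 a)@_m.
    rewrite mcoeff_rowB mcoeff_row_mdivX.
    by case: ifP; rewrite ?subrr ?subr0.
  case: ifPn => iS; last by rewrite mxE mcoeff0.
  rewrite inE gE // => /orP[/eqP -> |js jSm]; first by rewrite iS /= => ->.
  by case: ifP => // _; apply: IH js jSm.
have [e eE] := partial (enum 'I_N); exists e => S; apply/eqP.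
rewrite -subr_eq0; apply/eqP/rowP => a; rewrite [RHS]mxE.
apply/mpolyP => m; rewrite mcoeff0.
have [[i im]|mz] : (exists i, (i \notin S) || (m i != 0%N)) \/
    (S = setT /\ m = 0%MM).
  have [/existsP|] := boolP [exists i, (i \notin S) || (m i != 0%N)]; [by left|].
  rewrite negb_exists => /forallP H; right; split.
    by apply/setP => i; have := H i; rewrite negb_or negbK inE => /andP[-> _].
  by apply/mnmP => i; have := H i; rewrite negb_or !negbK mnm0E => /andP[_ /eqP].
  exact: (eE S a m i (mem_enum _ _) im).
have [-> ->] := mz; by rewrite mcoeff_rowB fT kdiff_coef0 subr0.
Qed.

End Coefficients.

(** * Graded cochains and the linear strand *)

Section Graded.
Variables (r : nat) (sh : 'I_r -> int).
Implicit Types (f g e : {set 'I_N} -> 'rV[R]_r) (v : 'rV[R]_r).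

Definition row_hpart (d : int) v : 'rV[R]_r := \row_a hpart (d - sh a) (v 0 a).

Lemma row_hpart_is_zmod_morphism d : zmod_morphism (row_hpart d).
Proof. by move=> v w; apply/rowP => a; rewrite !mxE raddfB. Qed.
HB.instance Definition _ d :=
  GRing.isZmodMorphism.Build _ _ (row_hpart d) (row_hpart_is_zmod_morphism d).

Lemma row_hpart_idem d v : row_hpart d (row_hpart d v) = row_hpart d v.
Proof. by apply/rowP => a; rewrite !mxE hpart_idem. Qed.

Lemma row_hpart_scale d i k v :
  row_hpart (d + 1) (((-1) ^+ k * 'X_i) *: v) = ((-1) ^+ k * 'X_i) *: row_hpart d v.
Proof.
apply/rowP => a; rewrite !mxE -!mulrA addrAC -signr_odd.
case: (odd k); rewrite ?expr0 ?expr1 ?mul1r ?mulN1r ?raddfN /= ?hpartXM //.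
Qed.

(* The cochains of the linear strand: f(S) has internal degree |S| - 1. *)
Definition strand (p : nat) f S : 'rV[R]_r :=
  if #|S| == p then row_hpart (p%:Z - 1) (f S) else 0.

Lemma strand_idem p f S : strand p (strand p f) S = strand p f S.
Proof. by rewrite /strand; case: eqP => // _; rewrite row_hpart_idem. Qed.

Lemma kdiff_strand p f S : kdiff (strand p f) S = strand p.+1 (kdiff f) S.
Proof.
rewrite /strand; case: eqP => pS.
  rewrite /kdiff raddf_sum; apply: eq_bigr => i iS /=.
  have -> : #|S :\ i| == p by have := cardsD1 i S; rewrite iS pS add1n => -[->].
  by rewrite -row_hpart_scale; congr (row_hpart _ _); lia.
rewrite /kdiff big1 // => i iS; case: eqP => [pSi|_]; last by rewrite scaler0.
by case: pS; rewrite (cardsD1 i) iS pSi.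
Qed.

Lemma strand_exact p f : (forall S, strand p.+1 f S = f S) ->
  (forall S, kdiff f S = 0) -> (forall a, (f setT 0 a)@_0%MM = 0) ->
  exists2 e, (forall S, strand p e S = e S) & forall S, f S = kdiff e S.
Proof.
move=> fp f0 fT; have [e fE] := kdiff_exact f0 fT.
exists (strand p e) => S; first exact: strand_idem.
rewrite kdiff_strand -fp /strand; case: ifP => // _; congr row_hpart.
exact: fE.
Qed.

(** Below the top cochain degree this removes the obstruction in [kdiff_exact]. *)
Lemma strand_setT p f a : (p < N)%N -> (forall S, strand p f S = f S) ->
  f setT 0 a = 0.
Proof.
by move=> pN <-; rewrite /strand cardsT card_ord eqn_leq leqNgt pN mxE.
Qed.

End Graded.

Section GradedMaps.
Variables (r r' : nat) (sh : 'I_r -> int) (sh' : 'I_r' -> int) (D : 'M[R]_(r, r')).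
Hypothesis D_homog : forall a b, homog_deg (sh a - sh' b) (D a b).
Implicit Types (f : {set 'I_N} -> 'rV[R]_r) (v : 'rV[R]_r).

Lemma row_hpart_mulmx d v : row_hpart sh' d (v *m D) = row_hpart sh d v *m D.
Proof.
apply/rowP => b; rewrite !mxE raddf_sum; apply: eq_bigr => a _ /=.
rewrite mxE -(hpartM _ _ (@D_homog a b)); congr (hpart _ _).
by rewrite addrA subrK.
Qed.

Lemma strand_mulmx p f S :
  strand sh' p (fun T => f T *m D) S = strand sh p f S *m D.
Proof.
by rewrite /strand; case: ifP => _; rewrite ?row_hpart_mulmx ?mul0mx.
Qed.

Lemma kdiff_mulmx f S : kdiff (fun T => f T *m D) S = kdiff f S *m D.
Proof.
by rewrite /kdiff mulmx_suml; apply: eq_bigr => i _; rewrite scalemxAl.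
Qed.

End GradedMaps.

End Koszul.

(** * The linear strand of Tor *)

Section Tor.
Variables (K : fieldType) (N : nat).
Local Notation R := {mpoly K[N]}.
Variables (I : R -> Prop) (F : graded_free_resolution I).
Local Notation rk := (gr_rank F).
Local Notation cochain r := ({set 'I_N} -> 'rV[R]_r).
Local Notation D k := (gr_diff F k).

Definition boundary k (v : 'rV[R]_(rk k)) := exists w, v = w *m D k.

Lemma boundaryP k v : boundary v <-> v *m D k = 0.
Proof. by rewrite (gr_exact (g := F)). Qed.

(* The Koszul class after [k + 1] steps of the zigzag. *)
Definition stage k := exists g : cochain (rk k),
  [/\ forall S, strand (@gr_shift _ _ _ F k) k.+2 g S = g S,
      forall S, boundary (kdiff g S)
    & ~ exists2 h : cochain (rk k), forall S, boundary (h S)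
          & forall S, kdiff h S = kdiff g S].

Lemma strand_diff k p (f : cochain (rk k.+1)) S :
  strand (@gr_shift _ _ _ F k) p (fun T => f T *m D k) S
  = strand (@gr_shift _ _ _ F k.+1) p f S *m D k.
Proof. exact/strand_mulmx/gr_diff_homog. Qed.

Lemma eq_strand r (sh : 'I_r -> int) p (f g : cochain r) S :
  (forall T, f T = g T) -> strand sh p f S = strand sh p g S.
Proof. by move=> fg; rewrite /strand fg. Qed.

(** The connecting map. Forwards, [kdiff g] is lifted along [D k]. Backwards, [g] followed by [D k]
    is a cocycle with values in a free module, hence a coboundary. The bound on [k] keeps both uses
    of exactness below the top degree. *)
Lemma stage_succ k : (k.+3 < N)%N -> stage k <-> stage k.+1.
Proof.
move=> kN; split=> -[g [gs gb gn]].
  have /fin_all_exists[w wE] := gb.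
  pose g1 := strand (@gr_shift _ _ _ F k.+1) k.+3 w.
  have g1E S : g1 S *m D k = kdiff g S.
    rewrite -strand_diff -(eq_kdiff S gs) kdiff_strand.
    by apply: eq_strand => T; rewrite wE.
  have g1s S : strand (@gr_shift _ _ _ F k.+1) k.+3 g1 S = g1 S.
    exact: strand_idem.
  exists g1; split=> // [S|[h hb hE]].
    by apply/boundaryP; rewrite -kdiff_mulmx (eq_kdiff S g1E) kdiff_kdiff.
  pose h1 := strand (@gr_shift _ _ _ F k.+1) k.+3 h.
  have h1s S : strand (@gr_shift _ _ _ F k.+1) k.+3 h1 S = h1 S by exact: strand_idem.
  have h1E S : h1 S *m D k = 0.
    rewrite -strand_diff (eq_strand _ _ (g := fun=> 0)) => [|T].
      by rewrite /strand raddf0 if_same.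
    exact/boundaryP.
  have [||e eE] := @kdiff_exact _ _ _ (fun T => g1 T - h1 T).
  - move=> S; rewrite kdiffB [kdiff h1 S]kdiff_strand (eq_strand _ _ _ hE) -kdiff_strand.
    by rewrite (eq_kdiff S g1s) subrr.
  - move=> a; rewrite mcoeff_rowB.
    by rewrite (strand_setT a kN g1s) (strand_setT a kN h1s) mcoeff0 subrr.
  case: gn; exists (fun S => e S *m D k) => S; first by exists (e S).
  by rewrite kdiff_mulmx -eE mulmxBl h1E subr0 g1E.
pose f S := g S *m D k.
have [||a|g1 g1s g1E] := @strand_exact _ _ _ (@gr_shift _ _ _ F k) k.+2 f.
- by move=> S; rewrite strand_diff gs.
- by move=> S; rewrite kdiff_mulmx; apply/boundaryP.
- rewrite (strand_setT (sh := @gr_shift _ _ _ F k) a kN) ?mcoeff0 // => S.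
  by rewrite strand_diff gs.
exists g1; split=> // [S|[h hb hE]]; first by rewrite -g1E; exists (g S).
have /fin_all_exists[e eE] := hb.
case: gn; exists (fun S => g S - kdiff e S) => S.
  apply/boundaryP; rewrite mulmxBl -kdiff_mulmx.
  have -> : kdiff (fun T => e T *m D k) S = kdiff h S.
    by apply: eq_kdiff => T; rewrite eE.
  by rewrite hE -g1E subrr.
by rewrite kdiffB kdiff_kdiff subr0.
Qed.

Hypothesis I_sub : forall f g, I f -> I g -> I (f - g).
Hypothesis I_mul : forall p f, I f -> I (p * f).
Hypothesis I_hpart : forall d f, I f -> I (hpart d f).

Let aug := gr_aug F.
Let sh0 : 'I_1 -> int := fun=> 0.

Lemma ideal0 : I 0.
Proof.
by have := (@gr_exact0 _ _ _ F 0).2; rewrite mul0mx mxE; apply; exists 0; rewrite mul0mx.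
Qed.

Lemma idealN f : I f -> I (- f).
Proof. by move=> If; rewrite -sub0r; apply: I_sub ideal0 If. Qed.

Lemma idealD f g : I f -> I g -> I (f + g).
Proof. by move=> If Ig; rewrite -[g]opprK; apply/I_sub/idealN. Qed.

Lemma ideal_kdiff (f : cochain 1) S : (forall T, I (f T 0 0)) -> I (kdiff f S 0 0).
Proof.
move=> If; rewrite /kdiff summxE; elim/big_rec: _ => [|i p _ Ip]; first exact: ideal0.
by rewrite mxE; apply: idealD Ip; apply: I_mul.
Qed.

Lemma ideal_strand p (f : cochain 1) S :
  (forall T, I (f T 0 0)) -> I (strand sh0 p f S 0 0).
Proof.
move=> If; rewrite /strand; case: ifP => _; rewrite mxE; last exact: ideal0.
exact: I_hpart.
Qed.

(** A nonzero class in the second Koszul cohomology of [R/I] in internal degree 1, represented by a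
    cochain with values in [R]. *)
Definition koszul_cocycle (b : cochain 1) : Prop :=
  [/\ forall S, strand sh0 2 b S = b S, forall S, I (kdiff b S 0 0)
    & ~ exists e : cochain 1, forall S, I ((b S - kdiff e S) 0 0)].

Lemma strand_aug p (f : cochain (rk 0)) S :
  strand sh0 p (fun T => f T *m aug) S = strand (@gr_shift _ _ _ F 0) p f S *m aug.
Proof.
apply: strand_mulmx => a b; rewrite [b]ord1 subr0; exact: gr_aug_homog.
Qed.

Lemma boundary0P (v : 'rV[R]_(rk 0)) : boundary v <-> I ((v *m aug) 0 0).
Proof. by rewrite (gr_exact0 (g := F)). Qed.

(** Values in [R/I] are lifted to [F_0] through the augmentation; the elements it sends into [I] are
    the boundaries. *)
Lemma koszul_cocycle_stage0 : (2 < N)%N ->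
  (exists b, koszul_cocycle b) <-> stage 0.
Proof.
move=> N2; split=> [[b [bs bI bn]]|[g [gs gb gn]]].
  have /fin_all_exists[w wE] S := gr_aug_surj F (b S 0 0).
  pose g := strand (@gr_shift _ _ _ F 0) 2 w.
  have gE S : I ((b S - g S *m aug) 0 0).
    rewrite -strand_aug -bs.
    have -> : strand sh0 2 b S - strand sh0 2 (fun T => w T *m aug) S
       = strand sh0 2 (fun T => b T - w T *m aug) S.
      by rewrite /strand; case: ifP => _; rewrite ?raddfB ?subr0.
    by apply: ideal_strand => T; rewrite !mxE; have := wE T; rewrite !mxE.
  have gs S : strand (@gr_shift _ _ _ F 0) 2 g S = g S by exact: strand_idem.
  exists g; split=> // [S|[h hb hE]].
    apply/boundary0P; rewrite -kdiff_mulmx.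
    have := I_sub (bI S) (ideal_kdiff S gE).
    by rewrite kdiffB !mxE opprB addrCA subrr addr0.
  pose h1 := strand (@gr_shift _ _ _ F 0) 2 h.
  have h1s S : strand (@gr_shift _ _ _ F 0) 2 h1 S = h1 S by exact: strand_idem.
  have h1I S : I ((h1 S *m aug) 0 0).
    by rewrite -strand_aug; apply: ideal_strand => T; apply/boundary0P.
  have [||e eE] := @kdiff_exact _ _ _ (fun T => g T - h1 T).
  - move=> S; rewrite kdiffB [kdiff h1 S]kdiff_strand (eq_strand _ _ _ hE) -kdiff_strand.
    by rewrite (eq_kdiff S gs) subrr.
  - move=> a; rewrite mcoeff_rowB.
    by rewrite (strand_setT a N2 gs) (strand_setT a N2 h1s) mcoeff0 subrr.
  case: bn; exists (fun S => e S *m aug) => S.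
  rewrite kdiff_mulmx -eE mulmxBl opprB addrCA addrC mxE; apply: idealD => //.
pose b S := g S *m aug.
exists b; split=> [S|S|[e eI]].
- by rewrite strand_aug gs.
- by rewrite kdiff_mulmx; apply/boundary0P.
have /fin_all_exists[w wE] S := gr_aug_surj F (e S 0 0).
case: gn; exists (fun S => g S - kdiff w S) => S; last first.
  by rewrite kdiffB kdiff_kdiff subr0.
apply/boundary0P; rewrite mulmxBl -kdiff_mulmx.
have H : I (kdiff (fun T => e T - w T *m aug) S 0 0).
  by apply: ideal_kdiff => T; have := wE T; rewrite !mxE.
set v := _ - _; have -> : v = (b S - kdiff e S) + kdiff (fun T => e T - w T *m aug) S.
  by rewrite kdiffB addrA subrK.
by rewrite mxE; apply: idealD.
Qed.

Definition row_const r (v : 'rV[R]_r) : 'rV[K]_r := map_mx (mcoeff 0%MM) v.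

Lemma row_const_mulmx k (v : 'rV[R]_(rk k.+1)) :
  row_const (v *m D k) = row_const v *m tor_diff F k.
Proof. exact: map_mxM. Qed.

Lemma row_const_kdiff r (f : cochain r) S : row_const (kdiff f S) = 0.
Proof. by apply/rowP => a; rewrite !mxE kdiff_coef0. Qed.

Definition row_C r (z : 'rV[K]_r) : 'rV[R]_r := map_mx (@mpolyC _ _) z.

Lemma row_CK r (z : 'rV[K]_r) : row_const (row_C z) = z.
Proof. by apply/rowP => a; rewrite !mxE mcoeffC eqxx mulr1. Qed.

Lemma gr_diff2 k : D k.+1 *m D k = 0.
Proof.
apply/row_matrixP => a; rewrite row_mul row0; apply/boundaryP.
by exists (delta_mx 0 a); rewrite -rowE.
Qed.

Lemma tor_diff2 k : tor_diff F k.+1 *m tor_diff F k = 0.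
Proof. by rewrite -map_mxM gr_diff2 map_mx0. Qed.

Lemma deg_partE i j (z : 'rV[K]_(rk i)) :
  (z *m deg_part F i j) = \row_a (if gr_shift a == j then z 0 a else 0).
Proof.
apply/rowP => a; rewrite mul_mx_diag !mxE.
by case: eqP => _; rewrite ?mulr1 ?mulr0.
Qed.

(** A nonzero constant entry of a homogeneous matrix joins generators of equal degree. *)
Lemma deg_part_tor_diff k j :
  deg_part F k.+1 j *m tor_diff F k = tor_diff F k *m deg_part F k j.
Proof.
apply/matrixP => a b; rewrite mul_diag_mx mul_mx_diag !mxE mulrC.
have [->|Dab] := eqVneq (D k a b)@_0%MM 0; first by rewrite !mul0r.
have := @gr_diff_homog _ _ _ F k a b 0%MM; rewrite mcoeff_msupp => /(_ Dab).
by rewrite mdeg0 => /esym/eqP; rewrite subr_eq0 => /eqP ->.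
Qed.

(** Boundaries of degree [j] are cycles, so the truncated difference of ranks is nonzero exactly
    when this inclusion is strict. *)
Lemma tor_dim_neq0 k j : tor_dim F k.+1 j <> 0%N <-> exists z : 'rV[K]_(rk k.+1),
  [/\ z *m deg_part F k.+1 j = z, z *m tor_diff F k = 0
    & ~ exists y, z = y *m tor_diff F k.+1].
Proof.
set dg := deg_part F k.+1 j; rewrite /tor_dim /= deg_part_tor_diff -/dg.
set A := (dg :&: _)%MS; set B := _ *m dg.
have dgdg : dg *m dg = dg.
  apply/matrixP => a b; rewrite /dg /deg_part mul_diag_mx !mxE.
  by case: eqP => _; rewrite ?mul1r // mul0rn mul0r.
have BA : (B <= A)%MS.
  rewrite sub_capmx submxMl /B -deg_part_tor_diff; apply/sub_kermxP.
  by rewrite -mulmxA tor_diff2 mulmx0.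
have -> : (\rank A - \rank B)%N <> 0%N <-> ~~ (A <= B)%MS.
  rewrite -(mxrank_leqif_sup BA); have := mxrankS BA.
  by move: (\rank A) (\rank B) => x y; split; lia.
split=> [/row_subPn[a]|[z [zd zT zn]]].
  set z := row a A => zB; have : (z <= A)%MS by exact: row_sub.
  rewrite sub_capmx => /andP[/submxP[w zw] /sub_kermxP zT]; exists z; split=> //.
    by rewrite zw -mulmxA dgdg.
  case=> y zy; case/negP: zB; apply/submxP; exists y.
  by rewrite /B mulmxA -zy zw -mulmxA dgdg.
apply/negP => AB; have : (z <= B)%MS.
  apply: submx_trans AB; rewrite sub_capmx -{1}zd submxMl.
  exact/sub_kermxP.
case/submxP=> w; rewrite /B -deg_part_tor_diff mulmxA => zE.
by apply: zn; exists (w *m deg_part F k.+2 j).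
Qed.

(** Here [kdiff g] lives only at [setT], where it is [w *m D k], and the constant term of [w] is the
    Tor cycle. If that term is a boundary, [w] can be corrected to have no constant term and becomes
    a Koszul coboundary, so that [g] is trivial. *)
Lemma stage_tor k : N = k.+3 -> stage k <-> tor_dim F k.+1 k.+2%:Z <> 0%N.
Proof.
move=> NE; rewrite tor_dim_neq0.
have strandT i (f : cochain (rk i)) S : strand (@gr_shift _ _ _ F i) k.+3 f S =
    if S == setT then row_hpart (@gr_shift _ _ _ F i) k.+2%:Z (f setT) else 0.
  rewrite /strand; have -> : (#|S| == k.+3) = (S == setT).
    rewrite eqEcard subsetT cardsT card_ord -NE eqn_leq.
    by have := subset_leq_card (subsetT S); rewrite cardsT card_ord => ->.
  by case: eqP => // ->; congr row_hpart; lia.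
split=> [[g [gs gb gn]]|[z [zd zT zn]]].
  have [w wE] := gb setT.
  pose w1 := row_hpart (@gr_shift _ _ _ F k.+1) k.+2%:Z w.
  have gT S : kdiff g S = if S == setT then w1 *m D k else 0.
    rewrite -(eq_kdiff S gs) kdiff_strand strandT wE.
    by case: ifP => // _; apply/row_hpart_mulmx/gr_diff_homog.
  exists (row_const w1); split.
  - rewrite deg_partE; apply/rowP => a; rewrite !mxE mcoeff_hpart mdeg0.
    by rewrite [0%:Z == _]eq_sym subr_eq0 eq_sym; case: eqP.
  - rewrite -row_const_mulmx -[w1 *m _](_ : kdiff g setT = _) ?row_const_kdiff //.
    by rewrite gT eqxx.
  case=> y wy; pose w2 := w1 - row_C y *m D k.+1.
  have [S|a|e eE] := @kdiff_exact _ _ _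
    (fun S : {set 'I_N} => if S == setT then w2 else 0).
  - rewrite /kdiff big1 // => i iS; case: eqP => [E|_]; last by rewrite scaler0.
    by have := in_setT i; rewrite -E !inE eqxx.
  - have /rowP/(_ a) : row_const w2 = 0.
      by rewrite /row_const map_mxB -!/(row_const _) row_const_mulmx row_CK wy subrr.
    by rewrite eqxx !mxE.
  case: gn; exists (fun S => e S *m D k) => S; first by exists (e S).
  rewrite kdiff_mulmx -eE gT; case: eqP => _; last exact: mul0mx.
  by rewrite mulmxBl -mulmxA gr_diff2 mulmx0 subr0.
pose w := row_C z; pose v := w *m D k.
have wh : row_hpart (@gr_shift _ _ _ F k.+1) k.+2%:Z w = w.
  apply/rowP => a; rewrite !mxE -zd deg_partE mxE; case: eqP => [->|_].
    rewrite subrr; apply/hpartP => m; rewrite mcoeff_msupp mcoeffC.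
    by have [->|_] := eqVneq m 0%MM; rewrite ?mdeg0 // mulr0 eqxx.
  by rewrite mpolyC0 raddf0.
pose f (S : {set 'I_N}) := if S == setT then v else 0.
have [S|S|a|g gs gE] := @strand_exact _ _ _ (@gr_shift _ _ _ F k) k.+2 f.
- rewrite strandT /f eqxx; case: ifP => // _; rewrite /v -[in RHS]wh.
  by apply/row_hpart_mulmx/gr_diff_homog.
- rewrite /kdiff big1 // => i iS; rewrite /f; case: eqP => [E|_]; last by rewrite scaler0.
  by have := in_setT i; rewrite -E !inE eqxx.
- have /rowP/(_ a) : row_const v = 0 by rewrite row_const_mulmx row_CK.
  by rewrite /f eqxx !mxE.
exists g; split=> // [S|[h hb hE]].
  rewrite -gE /f; case: ifP => _; first by exists w.
  by exists 0; rewrite mul0mx.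
have /fin_all_exists[e eE] := hb.
have : boundary (w - kdiff e setT).
  apply/boundaryP; rewrite mulmxBl -kdiff_mulmx.
  have -> : kdiff (fun T => e T *m D k) setT = kdiff h setT.
    by apply: eq_kdiff => T; rewrite eE.
  by rewrite hE -gE /f eqxx subrr.
case=> y yE; apply: zn; exists (row_const y).
rewrite -row_const_mulmx -yE /row_const map_mxB -!/(row_const _).
by rewrite row_CK row_const_kdiff subr0.
Qed.

Lemma koszul_cocycle_tor n : (1 < n)%N -> N = n.+1 ->
  (exists b, koszul_cocycle b) <-> tor_dim F n.-1 n%:Z <> 0%N.
Proof.
move=> n1 NE; rewrite koszul_cocycle_stage0 ?NE ?ltnS //.
case: n n1 NE => [|[|k]] // _ NE; rewrite -stage_tor //.
have : (k.+2 < N)%N by rewrite NE.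
elim: k {NE} => // k IH kN; rewrite IH ?(ltnW kN) //.
exact: stage_succ.
Qed.

End Tor.

(** * Koszul cocycles of a point set *)

Section LinearForms.
Variables (K : fieldType) (N : nat).
Local Notation R := {mpoly K[N]}.
Implicit Types (f : R) (u : 'I_N -> K) (v : 'rV[K]_N).

Definition linf u : R := \sum_i u i *: 'X_i.

Lemma mcoeff_linf u i : (linf u)@_U_(i) = u i.
Proof.
rewrite raddf_sum (bigD1 i) //= big1 ?addr0 => [|j ji]; rewrite mcoeffZ mcoeffXU.
  by rewrite eqxx mulr1.
by rewrite (negbTE ji) mulr0.
Qed.

Lemma linf_homog u : homog_deg 1 (linf u).
Proof.
apply/hpartP; rewrite raddf_sum; apply: eq_bigr => i _ /=; rewrite hpartZ.
congr (_ *: _); apply/hpartP => m; rewrite msuppX inE => /eqP ->.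
by rewrite mdeg1.
Qed.

Lemma linf_mcoeff f : homog_deg 1 f -> f = linf (fun i => f@_U_(i)).
Proof.
move=> f1; apply/mpolyP => m; have [/eqP md|md] := eqVneq (mdeg m)%:Z 1%Z.
  have /mdeg1P[i /eqP ->] : mdeg m == 1%N by [].
  by rewrite mcoeff_linf.
have z g : homog_deg 1 g -> g@_m = 0.
  by move/hpartP <-; rewrite mcoeff_hpart (negbTE md).
by rewrite !z //; apply: linf_homog.
Qed.

Lemma meval_linf u v : (linf u).@[v 0] = \sum_i u i * v 0 i.
Proof.
by rewrite raddf_sum; apply: eq_bigr => i _ /=; rewrite mevalZ mevalXU.
Qed.

Lemma linfN u : linf (fun i => - u i) = - linf u.
Proof. by rewrite -sumrN; apply: eq_bigr => j _; rewrite scaleNr. Qed.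

Lemma dhomog_homog_deg d f : f \is d.-homog <-> homog_deg d%:Z f.
Proof.
split=> [/dhomogP H m /H -> //|H]; apply/dhomogP => m /H.
by case.
Qed.

End LinearForms.

(** * The homogeneous ideal of the points *)

Section PointIdeal.
Variables (K : fieldType) (n : nat) (X : {fset pspace K n}).
Local Notation N := n.+1.
Local Notation R := {mpoly K[N]}.
Implicit Types (f g p : R).

Lemma point_ideal_sub f g : point_ideal X f -> point_ideal X g -> point_ideal X (f - g).
Proof.
move=> [s [sX ->]] [s' [s'X ->]]; exists (s ++ [seq (- h.1, h.2) | h <- s']); split.
  by move=> h; rewrite mem_cat => /orP[/sX //|/mapP[h' /s'X H ->]].
rewrite big_cat big_map /=; congr (_ + _); rewrite -sumrN.
by apply: eq_bigr => h _; rewrite mulNr.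
Qed.

Lemma point_ideal_mul p f : point_ideal X f -> point_ideal X (p * f).
Proof.
move=> [s [sX ->]]; exists [seq (p * h.1, h.2) | h <- s]; split.
  by move=> h /mapP[h' /sX H ->].
by rewrite big_map mulr_sumr; apply: eq_bigr => h _; rewrite mulrA.
Qed.

Lemma point_ideal_gen d f : homog_deg d%:Z f ->
  (forall P, P \in X -> vanishes_at f P) -> point_ideal X f.
Proof.
move=> fd fX; exists [:: (1, f)]; split; last by rewrite big_seq1 mul1r.
by move=> h; rewrite inE => /eqP ->; split=> //; exists d; apply/dhomog_homog_deg.
Qed.

Lemma point_ideal_hpart d f : point_ideal X f -> point_ideal X (hpart d f).
Proof.
move=> [s [sX ->]]; rewrite raddf_sum /= big_seq.
apply: (big_ind (point_ideal X)) => [|x y Ix Iy|h hs].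
- by exists [::]; rewrite big_nil.
- have -> : x + y = x - (-1 * y) by rewrite mulN1r opprK.
  by apply: point_ideal_sub => //; apply: point_ideal_mul.
have [[e /dhomog_homog_deg he] hX] := sX _ hs.
rewrite -(subrK e%:Z d) hpartM //; apply: point_ideal_mul.
exact: point_ideal_gen he hX.
Qed.

Lemma point_ideal_vanishes f P : point_ideal X f -> P \in X -> vanishes_at f P.
Proof.
move=> [s [sX ->]] PX v vP; rewrite rmorph_sum big_seq big1 // => h hs /=.
by have [_ /(_ P PX v vP) h0] := sX _ hs; rewrite rmorphM /= h0 mulr0.
Qed.

(** A linear form vanishing at the points vanishes on their span, which is everything. *)
Lemma point_ideal_deg1 f : spanning X -> point_ideal X f -> homog_deg 1 f -> f = 0.
Proof.
move=> spX If f1.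
have f0 (v : 'rV[K]_N) : f.@[v 0] = 0.
  have fE (w : 'rV[K]_N) : f.@[w 0] = \sum_i f@_U_(i) * w 0 i.
    by rewrite {1}(linf_mcoeff f1) meval_linf.
  have : v \in (\sum_(P <- X) val P)%VS by rewrite spX memvf.
  pose h : 'Hom('rV[K]_N, 'rV[K]_1) := linfun (mulmxr (\col_i f@_U_(i))).
  have hE w : h w = (f.@[w 0])%:M.
    rewrite lfunE /= fE; apply/matrixP => a b; rewrite !ord1 !mxE eqxx mulr1n.
    by apply: eq_bigr => i _; rewrite mxE mulrC.
  have : (\sum_(P <- X) val P <= lker h)%VS.
    rewrite big_seq; apply: (big_ind (fun U => (U <= lker h)%VS)) => [|U V|P PX].
    - exact: sub0v.
    - by rewrite subv_add => ->.
    apply/subvP => w wP; rewrite memv_ker hE.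
    by rewrite (point_ideal_vanishes If PX wP) raddf0.
  move=> /subvP H /H; rewrite memv_ker hE => /eqP/matrixP/(_ 0 0).
  by rewrite !mxE eqxx mulr1n.
rewrite (linf_mcoeff f1) /linf big1 // => i _.
have := f0 (delta_mx 0 i); rewrite {1}(linf_mcoeff f1) meval_linf (bigD1 i) //= big1.
  by rewrite !mxE !eqxx mulr1 addr0 => ->; rewrite scale0r.
by move=> j ji; rewrite !mxE (negbTE ji) andbF mulr0.
Qed.

End PointIdeal.

(** * Cochains on pairs and their differential on triples *)

Section PairCochains.
Variables (K : fieldType) (N : nat).
Local Notation R := {mpoly K[N]}.
Implicit Types (b : {set 'I_N} -> 'rV[R]_1) (p q r i j : 'I_N).

Lemma ksignU1 i j (T : {set 'I_N}) : j \notin T ->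
  ksign K i (j |: T) = ksign K i T * (-1) ^+ (j < i)%N.
Proof. by move=> jT; rewrite (@ksignD1 _ _ j) ?setU11 // setU1K. Qed.

Lemma ksign1 i j : ksign K i [set j] = (-1) ^+ (j < i)%N.
Proof.
have := @ksignU1 i j set0; rewrite setU0 => -> //; last by rewrite inE.
rewrite [X in X * _](_ : _ = 1) ?mul1r // /ksign -[RHS](expr0 (-1)).
by congr (_ ^+ _); apply: eq_card0 => k; rewrite !inE.
Qed.

(** The alternating function on ordered pairs that extends [b]. *)
Definition pair_coef b p q : R :=
  if (p < q)%N then b [set p; q] 0 0 else if (q < p)%N then - b [set p; q] 0 0 else 0.

Lemma pair_coefC b p q : pair_coef b q p = - pair_coef b p q.
Proof.
by rewrite /pair_coef setUC; case: ltngtP => _; rewrite ?opprK ?oppr0.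
Qed.

Lemma kdiff_pair b p q : (p < q)%N ->
  kdiff b [set p; q] 0 0 = 'X_p * b [set q] 0 0 - 'X_q * b [set p] 0 0.
Proof.
move=> pq; have pNq : p \notin [set q] by rewrite inE neq_ltn pq.
rewrite /kdiff big_setU1 //= big_set1 !mxE setU1K // !ksignU1 // !ksign1.
have -> : [set p; q] :\ q = [set p].
  by rewrite setUC setU1K // inE eq_sym neq_ltn pq.
by rewrite !ltnn pq ltnNge (ltnW pq) /= !expr0 expr1; ring.
Qed.

Lemma kdiff_triple b p q r : p != q -> q != r -> p != r ->
  exists k, kdiff b (p |: (q |: [set r])) 0 0 = (-1) ^+ k *
    ('X_p * pair_coef b q r + 'X_q * pair_coef b r p + 'X_r * pair_coef b p q).
Proof.
(* The exponent counts the inversions of [p, q, r]. *)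
move=> pq qr pr; exists ((q < p)%N + (r < p)%N + (r < q)%N)%N.
have pN : p \notin q |: [set r] by rewrite !inE negb_or pq.
have qN : q \notin [set r] by rewrite inE.
rewrite /kdiff big_setU1 //= big_setU1 //= big_set1 !mxE setU1K //.
have -> : (p |: (q |: [set r])) :\ q = p |: [set r].
  by rewrite setUCA setU1K // !inE negb_or eq_sym pq.
have -> : (p |: (q |: [set r])) :\ r = [set p; q].
  rewrite setUA setUC setU1K // !inE negb_or ![r == _]eq_sym pr.
  by rewrite qr.
rewrite !ksignU1 // !ksign1 /pair_coef [[set r; p]]setUC !ltnn.
move: pq qr pr; rewrite -!val_eqE /= !exprD.
by case: (ltngtP p q) => //; case: (ltngtP q r) => //; case: (ltngtP p r) => //;
  rewrite ?expr0 ?expr1; try lia; move=> *; ring.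
Qed.

Lemma card3P (S : {set 'I_N}) : #|S| = 3 -> exists p q r,
  [/\ p != q, q != r, p != r & S = p |: (q |: [set r])].
Proof.
move=> S3; have [S0|[p pS]] := set_0Vmem S; first by move: S3; rewrite S0 cards0.
have /eqP/cards2P[q [r [qr E]]] : #|S :\ p| = 2.
  by move: S3; rewrite (cardsD1 p) pS; case.
have := setD11 p S; rewrite E !inE => /negbT; rewrite negb_or => /andP[pq pr].
by exists p, q, r; split=> //; rewrite -E setD1K.
Qed.

End PairCochains.

Lemma wedge3_antisym (K : fieldType) N (v : 'rV[K]_N) (M : 'M[K]_N) p q r :
  M^T = - M -> (forall i, M i i = 0) ->
  (p != q -> q != r -> p != r -> wedge3 v M p q r = 0) -> wedge3 v M p q r = 0.
Proof.
move=> MT M0 H; have MC x y : M y x = - M x y.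
  by move/matrixP: MT => /(_ x y); rewrite !mxE.
have [pq|pq] := eqVneq p q; first by rewrite /wedge3 pq M0 (MC q r); ring.
have [qr|qr] := eqVneq q r; first by rewrite /wedge3 qr M0 (MC p r); ring.
have [pr|pr] := eqVneq p r; first by rewrite /wedge3 pr M0 (MC q r); ring.
exact: H.
Qed.

(** * Koszul cocycles as linear maps to bivectors *)

Section CocycleClass.
Variables (K : fieldType) (n : nat) (X : {fset pspace K n}).
Local Notation N := n.+1.
Local Notation R := {mpoly K[N]}.
Implicit Types (b : {set 'I_N} -> 'rV[R]_1) (B : 'I_N -> 'M[K]_N).

Local Notation cocycle := (koszul_cocycle (point_ideal X)).

Lemma lin_form_delta B i : lin_form B (delta_mx 0 i) = B i.
Proof.
rewrite /lin_form (bigD1 i) //= big1 ?addr0 => [|j /negbTE ji].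
  by rewrite mxE !eqxx scale1r.
by rewrite mxE ji andbF scale0r.
Qed.

Lemma strand_homog p b S : strand (fun=> 0) p b S = b S ->
  homog_deg (p%:Z - 1) (b S 0 0).
Proof.
rewrite /strand; case: ifP => _ <-; last by rewrite mxE => m; rewrite msupp0.
by rewrite mxE subr0; apply/hpartP; rewrite hpart_idem.
Qed.

Lemma strand_eq0 p b S : strand (fun=> 0) p b S = b S -> #|S| != p -> b S = 0.
Proof. by rewrite /strand => <- /negbTE ->. Qed.

Definition form_of_cochain b i : 'M[K]_N :=
  \matrix_(p, q) (pair_coef b p q)@_U_(i).

Lemma form_of_cochainT b i : (form_of_cochain b i)^T = - form_of_cochain b i.
Proof. by apply/matrixP => p q; rewrite !mxE pair_coefC mcoeffN. Qed.

Lemma form_of_cochain_diag b i p : form_of_cochain b i p p = 0.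
Proof. by rewrite mxE /pair_coef ltnn mcoeff0. Qed.

(** Evaluation at a vector [v] of a point turns membership of [kdiff b] in the ideal into
    [v /\ b(v) = 0]. A trivializing [w], read as the 1-cochain with value [w 0 q] at [[set q]],
    would make [b] a coboundary. *)
Lemma cocycle_class b : cocycle b -> koszul_class X (form_of_cochain b).
Proof.
move=> [bs bI bn]; have b1 S : homog_deg 1 (b S 0 0) by apply: (strand_homog (bs S)).
have pc1 p q : homog_deg 1 (pair_coef b p q).
  rewrite /pair_coef; case: ifP => // _; case: ifP => _; last by move=> m; rewrite msupp0.
  by apply/hpartP; rewrite raddfN /= (hpartP _ _).1.
have formE v p q : lin_form (form_of_cochain b) v p q = (pair_coef b p q).@[v 0].
  rewrite (linf_mcoeff (pc1 p q)) meval_linf summxE; apply: eq_bigr => i _.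
  by rewrite !mxE mulrC.
split; [exact: form_of_cochainT|exact: form_of_cochain_diag| |].
  move=> P v PX vP p q r; apply: wedge3_antisym.
  - exact/lin_formT/form_of_cochainT.
  - by move=> i; rewrite formE /pair_coef ltnn meval0.
  move=> pq qr pr; have [k E] := kdiff_triple b pq qr pr.
  have := point_ideal_vanishes (bI (p |: (q |: [set r]))) PX vP.
  rewrite E mevalM -signr_odd => /eqP; rewrite mulf_eq0 => /orP[].
    by case: (odd k); rewrite ?expr0 ?expr1 ?mevalN meval1 ?oppr_eq0 oner_eq0.
  by rewrite !mevalD !mevalM !mevalXU -!formE => /eqP.
case=> w wE; case: bn; pose e (S : {set 'I_N}) : 'rV[R]_1 :=
  const_mx (if #|S| == 1%N then \sum_(i in S) (w 0 i)%:MP else 0).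
exists e => S; suff -> : b S = kdiff e S.
  by rewrite subrr mxE; apply: (point_ideal_gen (d := 0)) => [m|P _ v _];
    rewrite ?msupp0 ?meval0.
have [S2|S2] := eqVneq #|S| 2; last first.
  rewrite (strand_eq0 (bs S)) // /kdiff big1 // => i iS.
  rewrite (_ : e _ = 0) ?scaler0 //; apply/rowP => a; rewrite !mxE ifN //.
  by apply: contra S2 => /eqP Si; rewrite (cardsD1 i) iS Si.
have [p [q [pq ->]]] : exists p q : 'I_N, (p < q)%N /\ S = [set p; q].
  move/eqP/cards2P: S2 => [p [q [pq ->]]]; move: pq; rewrite -val_eqE /=.
  by case: ltngtP => // pq _; [exists p, q | exists q, p; rewrite setUC].
apply/rowP => a; rewrite [a]ord1 kdiff_pair // !mxE !cards1 !eqxx !big_set1.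
have bE i : (b [set p; q] 0 0)@_U_(i) = (i == p)%:R * w 0 q - (i == q)%:R * w 0 p.
  have /matrixP/(_ p q) := wE (delta_mx 0 i); rewrite lin_form_delta !mxE /=.
  by rewrite /pair_coef pq ![_ == i]eq_sym.
rewrite (linf_mcoeff (b1 _)) /linf; under eq_bigr do rewrite bE scalerBl.
rewrite sumrB (bigD1 p) //= big1 ?addr0 => [|i /negbTE ip]; last first.
  by rewrite ip mul0r scale0r.
rewrite (bigD1 q) //= big1 ?addr0 => [|i /negbTE iq]; last first.
  by rewrite iq mul0r scale0r.
by rewrite !eqxx !mul1r -!mul_mpolyC ![_ * 'X__]mulrC.
Qed.

Definition cochain_of_form B (S : {set 'I_N}) : 'rV[R]_1 :=
  const_mx (if #|S| == 2 then
    \sum_(p in S) \sum_(q in S | (p < q)%N) linf (fun i => B i p q) else 0).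

Lemma pair_coef_cochain_of_form B p q : (forall i, (B i)^T = - B i) ->
  (forall i x, B i x x = 0) ->
  pair_coef (cochain_of_form B) p q = linf (fun i => B i p q).
Proof.
move=> BT B0; have lt (x y : 'I_N) : (x < y)%N ->
    cochain_of_form B [set x; y] 0 0 = linf (fun i => B i x y).
  move=> xy; rewrite mxE cards2 -val_eqE /= neq_ltn xy /=.
  rewrite big_setU1 ?inE ?neq_ltn ?xy //= big_set1.
  rewrite (bigD1 y) /= ?xy ?inE ?eqxx ?orbT // big1 => [|z]; last first.
    by rewrite !inE => /andP[/andP[/orP[]/eqP->]]; rewrite ?ltnn ?eqxx.
  rewrite big1 ?addr0 // => z; rewrite !inE => /andP[/orP[]/eqP->].
    by rewrite ltnNge (ltnW xy).
  by rewrite ltnn.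
rewrite /pair_coef; case: ltngtP => [pq|qp|/val_inj ->]; first exact: lt.
  rewrite setUC lt // -linfN; apply: eq_bigr => i _; congr (_ *: _).
  by have /matrixP/(_ p q) := BT i; rewrite !mxE => ->; rewrite opprK.
by rewrite /linf big1 // => i _; rewrite B0 scale0r.
Qed.

(** The values of [kdiff b] are quadrics vanishing on [X]. If [b - kdiff e] had values in the ideal,
    its linear part would be zero, as [X] lies on no hyperplane; the constants in [e] would then
    form a trivializing [w]. *)
Lemma class_cocycle B : spanning X -> koszul_class X B -> cocycle (cochain_of_form B).
Proof.
move=> spX [BT B0 BX Bn]; set b := cochain_of_form B.
have bs S : strand (fun=> 0) 2 b S = b S.
  rewrite /strand; case: eqP => S2; apply/rowP => a; last first.
    by rewrite !mxE; case: eqP.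
  rewrite ![b _]/cochain_of_form !mxE S2 eqxx subr0.
  rewrite !raddf_sum; apply: eq_bigr => p _ /=.
  by rewrite raddf_sum; apply: eq_bigr => q _ /=; apply/hpartP/linf_homog.
have bE p q : pair_coef b p q = linf (fun i => B i p q).
  exact: pair_coef_cochain_of_form.
split=> // [S|[e eI]].
  have k3 T : strand (fun=> 0) 3 (kdiff b) T = kdiff b T.
    by rewrite -kdiff_strand; apply: eq_kdiff.
  have [S3|S3] := eqVneq #|S| 3; last first.
    rewrite (strand_eq0 (k3 S)) // mxE.
    by apply: (point_ideal_gen (d := 0)) => [m|P _ v _]; rewrite ?msupp0 ?meval0.
  apply: (point_ideal_gen (d := 2)); first exact: (strand_homog (k3 S)).
  move=> P PX v vP; have [p [q [r [pq qr pr ->]]]] := card3P S3.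
  have [k ->] := kdiff_triple b pq qr pr.
  rewrite mevalM !mevalD !mevalM !mevalXU !bE !meval_linf.
  have lE x y : \sum_i B i x y * v 0 i = lin_form B v x y.
    by rewrite summxE; apply: eq_bigr => i _; rewrite mxE mulrC.
  by rewrite !lE -/(wedge3 v (lin_form B v) p q r) (BX P) ?mulr0.
pose e1 := strand (fun=> 0) 1 e.
have e1s S : strand (fun=> 0) 1 e1 S = e1 S by exact: strand_idem.
pose w : 'rV[K]_N := \row_q (e1 [set q] 0 0)@_0%MM.
have e1E q : e1 [set q] 0 0 = (w 0 q)%:MP.
  have := strand_homog (e1s [set q]); rewrite subrr => h0.
  apply/mpolyP => m; rewrite mcoeffC mxE; have [->|m0] := eqVneq m 0%MM.
    by rewrite mulr1.
  rewrite mulr0 -[e1 _ _ _]((hpartP 0 _).1 h0) mcoeff_hpart.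
  by case: eqP => // -[] /eqP; rewrite mdeg_eq0 (negbTE m0).
case: Bn; exists w; have key (p q : 'I_N) : (p < q)%N -> forall i,
    B i p q = (i == p)%:R * w 0 q - (i == q)%:R * w 0 p.
  move=> pq i.
  have h1 : homog_deg 1 (b [set p; q] 0 0) by apply: (strand_homog (bs _)).
  have h2 : homog_deg 1 (kdiff e1 [set p; q] 0 0).
    apply: (@strand_homog 2); rewrite -kdiff_strand; exact: eq_kdiff.
  have rowB (u v : 'rV[R]_1) : (u - v) 0 0 = u 0 0 - v 0 0 by rewrite !mxE.
  have b1 : b [set p; q] 0 0 - kdiff e1 [set p; q] 0 0 = 0.
    apply: (point_ideal_deg1 spX).
      have := point_ideal_hpart 1 (eI [set p; q]); rewrite rowB raddfB /=.
      rewrite ((hpartP 1 _).1 h1) kdiff_strand /strand cards2 -val_eqE /=.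
      by rewrite neq_ltn pq [row_hpart _ _ _ 0 0]mxE subr0.
    by apply/hpartP; rewrite raddfB /= !(hpartP _ _).1.
  have := congr1 (mcoeff U_(i)) b1.
  rewrite kdiff_pair // !e1E mcoeff0 !mcoeffB ![_ * _%:MP]mulrC !mcoeffCM !mcoeffXU.
  have := bE p q; rewrite /pair_coef pq => ->; rewrite mcoeff_linf => /eqP.
  by rewrite subr_eq0 => /eqP ->; rewrite ![_ == i]eq_sym ![w _ _ * _]mulrC.
move=> x; have half (p q : 'I_N) : (p < q)%N -> lin_form B x p q = wedge x w p q.
  move=> pq; rewrite summxE [RHS]mxE.
  under eq_bigr do rewrite mxE (key p q pq) mulrBr !mulrA.
  rewrite sumrB (bigD1 p) //= big1 ?addr0 => [|i /negbTE ip]; last first.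
    by rewrite ip mulr0 mul0r.
  rewrite (bigD1 q) //= big1 ?addr0 => [|i /negbTE iq]; last first.
    by rewrite iq mulr0 mul0r.
  by rewrite !eqxx !mulr1.
apply/matrixP => p q; have [pq|qp|/val_inj ->] := ltngtP p q; first exact: half.
  have /matrixP/(_ q p) := lin_formT x BT; rewrite mxE [RHS]mxE => ->.
  by have /matrixP/(_ q p) := wedgeT x w; rewrite mxE [RHS]mxE => ->; rewrite half.
rewrite wedge_diag summxE big1 // => i _; by rewrite mxE B0 mulr0.
Qed.

End CocycleClass.

Theorem mainTheorem2 (K : closedFieldType) (n : nat) (hn : (2 <= n)%N)
    (X : {fset pspace K n}) (hX : spanning X)
    (F : graded_free_resolution (point_ideal X)) :
  a_ F n.-1 <> 0%N <->
  on_rational_normal_curve X \/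
  exists k r : nat,
    [/\ (0 < k)%N, (0 < r)%N, (k + r)%N = n & on_linear_union X k r].
Proof.
(* For [i = n.-1] the degree [i.+1] is [n], as [n] is positive; this is the Tor group reached by the
   zigzag. *)
rewrite -(koszul_class_iff hn hX) /a_ prednK; last exact: ltnW.
rewrite -(koszul_cocycle_tor F (@point_ideal_sub _ _ X) (@point_ideal_mul _ _ X)
            (@point_ideal_hpart _ _ X) hn erefl).
split=> [[b /cocycle_class bB]|[B BX]]; first by exists (form_of_cochain b).
by exists (cochain_of_form B); apply: class_cocycle.
Qed.
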